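(* Let $\Lambda$ be a row-finite $k$-graph without sources and $\mathsf{k}$ any field. Then the following conditions are equivalent: (i) $\mathrm{KP}_{\mathsf{k}}(\Lambda)$ is semisimple; (ii) $T_\Lambda$ is atomic and $\mathbb{Z}^k$ acts freely on $T_\Lambda$; (iii) $T_\Lambda$ is atomic and each atom of $T_\Lambda$ is aperiodic; (iv) $\Lambda^0=\overline{\mathcal{B}(\Lambda)}$ and $\Lambda$ is aperiodic as a $k$-graph.
   Context: **$k$-graphs.** $\mathbb{N}=\{0,1,2,\dots\}$, $k\ge 1$, $e_i$ is the $i$-th standard generator of $\mathbb{N}^k$; $\mathbb{N}^k$ is ordered coordinatewise, with $m\vee n$ the coordinatewise maximum. A $k$-graph is a countable small category $\Lambda$ with object set $\Lambda^0$ (identified with the identity morphisms), range and source maps $r,s:\Lambda\to\Lambda^0$, and a functor $d:\Lambda\to\mathbb{N}^k$ with the unique factorization property: if $d(\lambda)=m+n$ there are unique $\mu_1,\mu_2\in\Lambda$ with $\lambda=\mu_1\mu_2$, $d(\mu_1)=m$, $d(\mu_2)=n$ (the product $\mu_1\mu_2$ is defined iff $s(\mu_1)=r(\mu_2)$). $v\Lambda=r^{-1}(v)$, $v\Lambda^n=\{\lambda\in v\Lambda: d(\lambda)=n\}$. $\Lambda$ is row-finite if every $v\Lambda^n$ is finite, and has no sources if every $v\Lambda^n$ is nonempty. $H\subseteq\Lambda^0$ is hereditary if $r(\lambda)\in H$ implies $s(\lambda)\in H$; saturated if $s(v\Lambda^n)\subseteq H$ (for some $n\in\mathbb{N}^k$)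 implies $v\in H$. For $X\subseteq\Lambda^0$, $\overline{X}$ is the smallest hereditary and saturated subset containing $X$. A vertex $v$ is a leaf if $|v\Lambda^m|=1$ for all $m\in\mathbb{N}^k$; $\mathcal{B}(\Lambda)$ is the set of leaves. **Aperiodicity of $\Lambda$ (Lewin–Sims).** For $0\le m\le n\le d(\lambda)$, $\lambda(m,n)$ denotes the unique path $\mu_2$ with $\lambda=\mu_1\mu_2\mu_3$, $d(\mu_1)=m$, $d(\mu_2)=n-m$. $\mathrm{MCE}(\lambda,\mu)$ is the set of $\tau\in\Lambda$ with $d(\tau)=d(\lambda)\vee d(\mu)$, $\tau(0,d(\lambda))=\lambda$, $\tau(0,d(\mu))=\mu$. $\Lambda$ is aperiodic if for every pair of distinct paths $\alpha,\beta\in\Lambda$ with $s(\alpha)=s(\beta)$ there is $\tau\in s(\alpha)\Lambda$ with $\mathrm{MCE}(\alpha\tau,\beta\tau)=\emptyset$. **Talented monoid.** $T_\Lambda$ is the commutative monoid generated by symbols $v(n)$ ($v\in\Lambda^0$, $n\in\mathbb{Z}^k$) subject to $v(n)=\sum_{\alpha\in v\Lambda^{e_i}}s(\alpha)(n+e_i)$ for all $v$, $n$ and $i\in\{1,\dots,k\}$ with $v\Lambda^{e_i}\neq\emptyset$. $\mathbb{Z}^k$ acts on it by monoid automorphisms determined by ${}^{n}v(m)=v(m+n)$. With $x\le y$ iff $y=x+z$ for some $z$, a unit is an element $u\le 0$; a nonunit $a$ is an atom if $a=b+c$ implies $b$ or $c$ is a unit; a monoid is atomic if every nonunit is a finite sum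 of atoms. A nonzero $a$ is periodic if ${}^{n}a=a$ for some $0\ne n\in\mathbb{Z}^k$, otherwise aperiodic; the action is free if there is no (nonzero) periodic element. **Kumjian–Pask algebra.** Let $\Lambda^{\neq0}=\{\lambda: d(\lambda)\ne 0\}$. $\mathrm{KP}_{\mathsf{k}}(\Lambda)$ is the universal $\mathsf{k}$-algebra generated by elements $p_v$ ($v\in\Lambda^0$), $s_\lambda,s_{\lambda^*}$ ($\lambda\in\Lambda^{\neq 0}$) subject to: (KP1) $p_up_v=\delta_{u,v}p_u$; (KP2) $s_\lambda s_\mu=s_{\lambda\mu}$, $s_{\mu^*}s_{\lambda^*}=s_{(\lambda\mu)^*}$ when $s(\lambda)=r(\mu)$, and $p_{r(\lambda)}s_\lambda=s_\lambda=s_\lambda p_{s(\lambda)}$, $p_{s(\lambda)}s_{\lambda^*}=s_{\lambda^*}=s_{\lambda^*}p_{r(\lambda)}$; (KP3) $s_{\lambda^*}s_\mu=\delta_{\lambda,\mu}p_{s(\lambda)}$ when $d(\lambda)=d(\mu)$; (KP4) $p_v=\sum_{\lambda\in v\Lambda^n}s_\lambda s_{\lambda^*}$ for all $v\in\Lambda^0$, $n\in\mathbb{N}^k$ (with $s_v=s_{v^*}=p_v$ for $v\in\Lambda^0$). It is semisimple if it equals its socle, the sum of its minimal left ideals. *)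

(* Defs.v *)
From HB Require Import structures.
From mathcomp Require Import all_boot all_order all_algebra finmap.
From mathcomp Require Import boolp classical_sets functions cardinality.

Set Implicit Arguments.
Unset Strict Implicit.
Unset Printing Implicit Defensive.

Import GRing.Theory.
Local Open Scope classical_set_scope.
Local Open Scope ring_scope.
Local Open Scope quotient_scope.

(* The composite [pcomp l m] (diagrammatically, the path "l m") is meaningful
   only when [src l = rng m]; its value is arbitrary otherwise.  Objects are
   kept apart from morphisms and embedded by [idp]. *)
Record kgraph (k : nat) := KGraph {
  vertex : countType;
  mor : countType;
  rng : mor -> vertex;
  src : mor -> vertex;
  idp : vertex -> mor;
  pcomp : mor -> mor -> mor;
  deg : mor -> 'rV[nat]_k;
  rng_idp : forall v, rng (idp v) = v;
  src_idp : forall v, src (idp v) = v;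
  rng_comp : forall l m, src l = rng m -> rng (pcomp l m) = rng l;
  src_comp : forall l m, src l = rng m -> src (pcomp l m) = src m;
  pcomp_idl : forall l, pcomp (idp (rng l)) l = l;
  pcomp_idr : forall l, pcomp l (idp (src l)) = l;
  pcompA : forall l m n, src l = rng m -> src m = rng n ->
    pcomp l (pcomp m n) = pcomp (pcomp l m) n;
  deg_idp : forall v, deg (idp v) = 0;
  deg_comp : forall l m, src l = rng m -> deg (pcomp l m) = deg l + deg m;
  unique_factorization : forall l m n, deg l = m + n ->
    exists! p : mor * mor,
      [/\ src p.1 = rng p.2, l = pcomp p.1 p.2, deg p.1 = m & deg p.2 = n]
}.

Section KGraphTheory.
Variables (k : nat) (L : kgraph k).
Implicit Types (v : vertex L) (l m t : mor L) (H X : set (vertex L)).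

Definition paths_from v (n : 'rV[nat]_k) : set (mor L) :=
  [set l | rng l = v /\ deg l = n].

Definition row_finite := forall v n, finite_set (paths_from v n).

Definition no_sources := forall v n, paths_from v n !=set0.

Definition hereditary H := forall l, H (rng l) -> H (src l).

Definition saturated H :=
  forall v n, @src _ L @` paths_from v n `<=` H -> H v.

Definition hs_closure X : set (vertex L) :=
  smallest [set H | hereditary H /\ saturated H] X.

Definition leaf v := forall n, exists l, paths_from v n = [set l].

Definition leaves : set (vertex L) := [set v | leaf v].

(* [segment l a b m] says that m = l(a, b). *)
Definition segment l (a b : 'rV[nat]_k) m := exists m1 m3,
  [/\ src m1 = rng m, src m = rng m3, l = pcomp (pcomp m1 m) m3,
      deg m1 = a & b = a + deg m].

Definition deg_join (a b : 'rV[nat]_k) : 'rV[nat]_k :=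
  \row_i maxn (a 0 i) (b 0 i).

Definition MCE l m : set (mor L) :=
  [set t | [/\ deg t = deg_join (deg l) (deg m),
               segment t 0 (deg l) l & segment t 0 (deg m) m]].

Definition kgraph_aperiodic := forall l m, l <> m -> src l = src m ->
  exists t, rng t = src l /\ MCE (pcomp l t) (pcomp m t) = set0.

End KGraphTheory.

Arguments leaves {k} L _.

Section Monoids.
Variable M : nmodType.
Implicit Types a b c x y z : M.

Definition alg_le x y := exists z, y = x + z.

Definition munit x := alg_le x 0.

Definition atom a :=
  ~ munit a /\ forall b c, a = b + c -> munit b \/ munit c.

Definition atomic := forall a, ~ munit a ->
  exists s : seq M, {in s, forall x, atom x} /\ a = \sum_(x <- s) x.

End Monoids.

(* The monoid is presented as a quotient of the type of formal expressions in
   the generators by the smallest congruence containing the commutative monoid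
   axioms and the defining relations. *)
Section TalentedMonoid.
Variables (k : nat) (L : kgraph k).

Inductive tterm :=
  | TZero
  | TAdd of tterm & tterm
  | TGen of vertex L & 'rV[int]_k.

(* [fset_set A] enumerates A when A is finite, and is empty otherwise; hence
   the sum below is the intended one for row-finite graphs. *)
Inductive tequiv : tterm -> tterm -> Prop :=
  | tequiv_refl x : tequiv x x
  | tequiv_sym x y : tequiv x y -> tequiv y x
  | tequiv_trans x y z : tequiv x y -> tequiv y z -> tequiv x z
  | tequiv_add x x' y y' :
      tequiv x x' -> tequiv y y' -> tequiv (TAdd x y) (TAdd x' y')
  | tequiv_add0 x : tequiv (TAdd TZero x) x
  | tequiv_addC x y : tequiv (TAdd x y) (TAdd y x)
  | tequiv_addA x y z : tequiv (TAdd x (TAdd y z)) (TAdd (TAdd x y) z)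
  | tequiv_gen v n (i : 'I_k) : paths_from v (delta_mx 0 i) !=set0 ->
      tequiv (TGen v n)
        (\big[TAdd/TZero]_(l <- fset_set (paths_from v (delta_mx 0 i)))
           TGen (src l) (n + delta_mx 0 i)).

HB.instance Definition _ := gen_eqMixin tterm.
HB.instance Definition _ := gen_choiceMixin tterm.

Definition tequivb (x y : tterm) : bool := `[< tequiv x y >].

Lemma tequivb_equiv : equiv_class_of tequivb.
Proof.
split=> [x|x y|y x z].
- exact/asboolP/tequiv_refl.
- by apply/asboolP/asboolP; apply: tequiv_sym.
- by move=> /asboolP xy /asboolP yz; apply/asboolP/(tequiv_trans xy).
Qed.

Canonical tequivb_equiv_rel := EquivRelPack tequivb_equiv.

Definition talented := {eq_quot tequivb}.
HB.instance Definition _ := EqQuotient.on talented.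
HB.instance Definition _ := Choice.on talented.

Lemma talentedP x y : reflect (tequiv x y) (\pi_talented x == \pi_talented y).
Proof. by rewrite piE; apply: asboolP. Qed.

Lemma talented_repr x : tequiv (repr (\pi_talented x)) x.
Proof. by apply/talentedP; rewrite reprK. Qed.

Definition talented_zero : talented := \pi_talented TZero.
Definition talented_add (x y : talented) : talented :=
  \pi_talented (TAdd (repr x) (repr y)).

Lemma talented_piD x y :
  \pi_talented (TAdd x y) = talented_add (\pi_talented x) (\pi_talented y).
Proof.
by apply/eqP/talentedP/tequiv_sym; apply: tequiv_add; apply: talented_repr.
Qed.

Lemma talented_addA : associative talented_add.
Proof.
elim/quotW=> x; elim/quotW=> y; elim/quotW=> z.
rewrite -(talented_piD y z) -(talented_piD x y) -!talented_piD.
apply/eqP/talentedP; exact: tequiv_addA.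
Qed.

Lemma talented_addC : commutative talented_add.
Proof.
elim/quotW=> x; elim/quotW=> y; rewrite -!talented_piD.
apply/eqP/talentedP; exact: tequiv_addC.
Qed.

Lemma talented_add0 : left_id talented_zero talented_add.
Proof.
by elim/quotW=> x; rewrite -talented_piD; apply/eqP/talentedP/tequiv_add0.
Qed.

HB.instance Definition _ := GRing.isNmodule.Build talented
  talented_addA talented_addC talented_add0.

Definition tgen v n : talented := \pi_talented (TGen v n).

Fixpoint tterm_shift (n : 'rV[int]_k) (x : tterm) : tterm :=
  match x with
  | TZero => TZero
  | TAdd y z => TAdd (tterm_shift n y) (tterm_shift n z)
  | TGen v m => TGen v (m + n)
  end.

Definition tshift n (x : talented) : talented := \pi_talented (tterm_shift n (repr x)).

Lemma tterm_shift_equiv n x y :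
  tequiv x y -> tequiv (tterm_shift n x) (tterm_shift n y).
Proof.
elim=> {x y} /=; try by eauto using tequiv.
move=> v m i /(tequiv_gen (m + n)); congr tequiv.
elim/big_rec2: _ => //= l x y _ ->.
by rewrite addrAC.
Qed.

Lemma tshift_pi n x : tshift n (\pi_talented x) = \pi_talented (tterm_shift n x).
Proof. exact/eqP/talentedP/tterm_shift_equiv/talented_repr. Qed.

Lemma tshift_gen n v m : tshift n (tgen v m) = tgen v (m + n).
Proof. by rewrite tshift_pi. Qed.

Lemma tshift0 n : tshift n 0 = 0.
Proof. exact: tshift_pi. Qed.

Lemma tshiftD n : {morph tshift n : x y / x + y}.
Proof.
elim/quotW=> x; elim/quotW=> y.
by rewrite -[_ + _]talented_piD !tshift_pi [LHS]talented_piD.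
Qed.

Definition tperiodic (a : talented) :=
  a <> 0 /\ exists n : 'rV[int]_k, n <> 0 /\ tshift n a = a.

Definition taperiodic (a : talented) := a <> 0 /\ ~ tperiodic a.

Definition tfree := forall a : talented, ~ tperiodic a.

End TalentedMonoid.

(* Presented, as above, by formal expressions modulo the smallest congruence
   containing the axioms of (possibly nonunital) associative F-algebras and
   the Kumjian-Pask relations. *)
Section KumjianPask.
Variables (F : fieldType) (k : nat) (L : kgraph k).

Definition npath := {l : mor L | deg l != 0}.

Inductive kpterm :=
  | KZero
  | KOpp of kpterm
  | KAdd of kpterm & kpterm
  | KScale of F & kpterm
  | KMul of kpterm & kpterm
  | KVertex of vertex L
  | KPath of npath
  | KGhost of npath.

(* The convention s_v = s_{v*} = p_v: a path of degree 0 is an identity. *)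
Definition kps (l : mor L) : kpterm :=
  if insub l is Some l' then KPath l' else KVertex (rng l).
Definition kpst (l : mor L) : kpterm :=
  if insub l is Some l' then KGhost l' else KVertex (rng l).

Inductive kpequiv : kpterm -> kpterm -> Prop :=
  | kpequiv_refl x : kpequiv x x
  | kpequiv_sym x y : kpequiv x y -> kpequiv y x
  | kpequiv_trans x y z : kpequiv x y -> kpequiv y z -> kpequiv x z
  | kpequiv_opp x x' : kpequiv x x' -> kpequiv (KOpp x) (KOpp x')
  | kpequiv_add x x' y y' :
      kpequiv x x' -> kpequiv y y' -> kpequiv (KAdd x y) (KAdd x' y')
  | kpequiv_scale a x x' : kpequiv x x' -> kpequiv (KScale a x) (KScale a x')
  | kpequiv_mul x x' y y' :
      kpequiv x x' -> kpequiv y y' -> kpequiv (KMul x y) (KMul x' y')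
  | kpequiv_addA x y z : kpequiv (KAdd x (KAdd y z)) (KAdd (KAdd x y) z)
  | kpequiv_addC x y : kpequiv (KAdd x y) (KAdd y x)
  | kpequiv_add0 x : kpequiv (KAdd KZero x) x
  | kpequiv_addN x : kpequiv (KAdd (KOpp x) x) KZero
  | kpequiv_scaleA a b x :
      kpequiv (KScale a (KScale b x)) (KScale (a * b) x)
  | kpequiv_scale1 x : kpequiv (KScale 1 x) x
  | kpequiv_scaleDr a x y :
      kpequiv (KScale a (KAdd x y)) (KAdd (KScale a x) (KScale a y))
  | kpequiv_scaleDl a b x :
      kpequiv (KScale (a + b) x) (KAdd (KScale a x) (KScale b x))
  | kpequiv_mulA x y z : kpequiv (KMul x (KMul y z)) (KMul (KMul x y) z)
  | kpequiv_mulDl x y z :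
      kpequiv (KMul (KAdd x y) z) (KAdd (KMul x z) (KMul y z))
  | kpequiv_mulDr x y z :
      kpequiv (KMul x (KAdd y z)) (KAdd (KMul x y) (KMul x z))
  | kpequiv_scaleAl a x y :
      kpequiv (KMul (KScale a x) y) (KScale a (KMul x y))
  | kpequiv_scaleAr a x y :
      kpequiv (KMul x (KScale a y)) (KScale a (KMul x y))
  | kpequiv_vertex u v :
      kpequiv (KMul (KVertex u) (KVertex v))
              (if u == v then KVertex u else KZero)
  | kpequiv_path l m : src l = rng m ->
      kpequiv (KMul (kps l) (kps m)) (kps (pcomp l m))
  | kpequiv_ghost l m : src l = rng m ->
      kpequiv (KMul (kpst m) (kpst l)) (kpst (pcomp l m))
  | kpequiv_rng_path l : kpequiv (KMul (KVertex (rng l)) (kps l)) (kps l)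
  | kpequiv_path_src l : kpequiv (KMul (kps l) (KVertex (src l))) (kps l)
  | kpequiv_src_ghost l : kpequiv (KMul (KVertex (src l)) (kpst l)) (kpst l)
  | kpequiv_ghost_rng l : kpequiv (KMul (kpst l) (KVertex (rng l))) (kpst l)
  | kpequiv_ghost_path l m : deg l = deg m ->
      kpequiv (KMul (kpst l) (kps m))
              (if l == m then KVertex (src l) else KZero)
  | kpequiv_path_ghost v n :
      kpequiv (KVertex v)
        (\big[KAdd/KZero]_(l <- fset_set (paths_from v n))
           KMul (kps l) (kpst l)).

HB.instance Definition _ := gen_eqMixin kpterm.
HB.instance Definition _ := gen_choiceMixin kpterm.

Definition kpequivb (x y : kpterm) : bool := `[< kpequiv x y >].

Lemma kpequivb_equiv : equiv_class_of kpequivb.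
Proof.
split=> [x|x y|y x z].
- exact/asboolP/kpequiv_refl.
- by apply/asboolP/asboolP; apply: kpequiv_sym.
- by move=> /asboolP xy /asboolP yz; apply/asboolP/(kpequiv_trans xy).
Qed.

Canonical kpequivb_equiv_rel := EquivRelPack kpequivb_equiv.

Definition KP := {eq_quot kpequivb}.
HB.instance Definition _ := EqQuotient.on KP.
HB.instance Definition _ := Choice.on KP.

Lemma kpP x y : reflect (kpequiv x y) (\pi_KP x == \pi_KP y).
Proof. by rewrite piE; apply: asboolP. Qed.

Lemma kp_repr x : kpequiv (repr (\pi_KP x)) x.
Proof. by apply/kpP; rewrite reprK. Qed.

Definition kp_zero : KP := \pi_KP KZero.
Definition kp_opp (x : KP) : KP := \pi_KP (KOpp (repr x)).
Definition kp_add (x y : KP) : KP := \pi_KP (KAdd (repr x) (repr y)).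
Definition kp_scale (a : F) (x : KP) : KP := \pi_KP (KScale a (repr x)).
Definition kp_mul (x y : KP) : KP := \pi_KP (KMul (repr x) (repr y)).

Lemma kp_piN x : \pi_KP (KOpp x) = kp_opp (\pi_KP x).
Proof. by apply/eqP/kpP/kpequiv_sym/kpequiv_opp/kp_repr. Qed.

Lemma kp_piD x y : \pi_KP (KAdd x y) = kp_add (\pi_KP x) (\pi_KP y).
Proof. by apply/eqP/kpP/kpequiv_sym; apply: kpequiv_add; apply: kp_repr. Qed.

Lemma kp_piZ a x : \pi_KP (KScale a x) = kp_scale a (\pi_KP x).
Proof. by apply/eqP/kpP/kpequiv_sym/kpequiv_scale/kp_repr. Qed.

Lemma kp_piM x y : \pi_KP (KMul x y) = kp_mul (\pi_KP x) (\pi_KP y).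
Proof. by apply/eqP/kpP/kpequiv_sym; apply: kpequiv_mul; apply: kp_repr. Qed.

Lemma kp_addA : associative kp_add.
Proof.
elim/quotW=> x; elim/quotW=> y; elim/quotW=> z; rewrite -(kp_piD y z) -(kp_piD x y) -!kp_piD.
apply/eqP/kpP; exact: kpequiv_addA.
Qed.

Lemma kp_addC : commutative kp_add.
Proof.
elim/quotW=> x; elim/quotW=> y; rewrite -!kp_piD.
apply/eqP/kpP; exact: kpequiv_addC.
Qed.

Lemma kp_add0 : left_id kp_zero kp_add.
Proof. by elim/quotW=> x; rewrite -kp_piD; apply/eqP/kpP/kpequiv_add0. Qed.

Lemma kp_addN : left_inverse kp_zero kp_opp kp_add.
Proof. by elim/quotW=> x; rewrite -kp_piN -kp_piD; apply/eqP/kpP/kpequiv_addN. Qed.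

HB.instance Definition _ := GRing.isZmodule.Build KP
  kp_addA kp_addC kp_add0 kp_addN.

Lemma kp_scaleA a b x : kp_scale a (kp_scale b x) = kp_scale (a * b) x.
Proof.
by elim/quotW: x => x; rewrite -(kp_piZ b x) -!kp_piZ; apply/eqP/kpP/kpequiv_scaleA.
Qed.

Lemma kp_scale1 : left_id 1 kp_scale.
Proof. by elim/quotW=> x; rewrite -kp_piZ; apply/eqP/kpP/kpequiv_scale1. Qed.

Lemma kp_scaleDr : right_distributive kp_scale +%R.
Proof.
move=> a; elim/quotW=> x; elim/quotW=> y.
rewrite -![_ + _ :> KP]/(kp_add _ _) -(kp_piD x y) -(kp_piZ a x) -(kp_piZ a y) -kp_piZ -kp_piD.
apply/eqP/kpP; exact: kpequiv_scaleDr.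
Qed.

Lemma kp_scaleDl x : {morph kp_scale^~ x : a b / a + b}.
Proof.
move=> a b; elim/quotW: x => x.
rewrite -![_ + _ :> KP]/(kp_add _ _) -(kp_piZ a x) -(kp_piZ b x) -kp_piZ -kp_piD.
apply/eqP/kpP; exact: kpequiv_scaleDl.
Qed.

HB.instance Definition _ := GRing.Zmodule_isLmodule.Build F KP
  kp_scaleA kp_scale1 kp_scaleDr kp_scaleDl.

Lemma kp_mulA : associative kp_mul.
Proof.
elim/quotW=> x; elim/quotW=> y; elim/quotW=> z; rewrite -(kp_piM y z) -(kp_piM x y) -!kp_piM.
apply/eqP/kpP; exact: kpequiv_mulA.
Qed.

Lemma kp_mulDl : left_distributive kp_mul +%R.
Proof.
elim/quotW=> x; elim/quotW=> y; elim/quotW=> z.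
rewrite -![_ + _ :> KP]/(kp_add _ _) -(kp_piD x y) -(kp_piM x z) -(kp_piM y z) -kp_piM -kp_piD.
apply/eqP/kpP; exact: kpequiv_mulDl.
Qed.

Lemma kp_mulDr : right_distributive kp_mul +%R.
Proof.
elim/quotW=> x; elim/quotW=> y; elim/quotW=> z.
rewrite -![_ + _ :> KP]/(kp_add _ _) -(kp_piD y z) -(kp_piM x y) -(kp_piM x z) -kp_piM -kp_piD.
apply/eqP/kpP; exact: kpequiv_mulDr.
Qed.

Lemma kp_scaleAl a (x y : KP) : kp_mul (a *: x) y = a *: kp_mul x y.
Proof.
elim/quotW: x => x; elim/quotW: y => y.
rewrite -![_ *: _]/(kp_scale _ _) -(kp_piZ a x) -(kp_piM x y) -kp_piM -kp_piZ.
apply/eqP/kpP; exact: kpequiv_scaleAl.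
Qed.

Lemma kp_scaleAr a (x y : KP) : kp_mul x (a *: y) = a *: kp_mul x y.
Proof.
elim/quotW: x => x; elim/quotW: y => y.
rewrite -![_ *: _]/(kp_scale _ _) -(kp_piZ a y) -(kp_piM x y) -kp_piM -kp_piZ.
apply/eqP/kpP; exact: kpequiv_scaleAr.
Qed.

End KumjianPask.

(* The multiplication is an explicit argument since the rings under
   consideration need not be unital. *)
Section Socle.
Variables (A : zmodType) (mul : A -> A -> A).

Definition left_ideal (I : set A) :=
  [/\ I 0, forall x y, I x -> I y -> I (x - y)
    & forall a x, I x -> I (mul a x)].

Definition minimal_left_ideal (I : set A) :=
  [/\ left_ideal I, I <> [set 0]
    & forall J, left_ideal J -> J `<=` I -> J = [set 0] \/ J = I].

Definition socle : set A :=
  [set x | exists s : seq A,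
    {in s, forall y, exists I, minimal_left_ideal I /\ I y} /\
    x = \sum_(y <- s) y].

Definition semisimple := socle = setT.

End Socle.

(* Main.v *)
From mathcomp Require Import all_boot all_order all_algebra finmap.
From mathcomp Require Import boolp cardinality.
From mathcomp Require Import classical_sets.
Require Import Defs.

(** All four conditions are equivalent to the conjunction of two statements
    about the graph.

    (a) Every vertex [v] is leafy: for some degree [m], all the paths of degree
        [m] from [v] end in leaves.  The leafy vertices are exactly the
        hereditary saturated closure of the leaves ([hs_closure_leaves]).

    (b) Two paths of different degrees out of the same leaf never have the same
        source ([leaf_aperiodic]).  Given (a), this is aperiodicity of the graph
        ([kgraph_aperiodicP]): two paths of the same degree are separated
        already, and two paths of different degrees can be prolonged by a path
        that ends in a leaf, past which a common extension would be a return of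
        the infinite path out of that leaf to a vertex.

    Talented monoid.  The number of paths from the generators of an expression
    to a level [N], sorted by their sources, does not depend on the expression
    chosen for an element as soon as [N] is high ([tcount_equiv]).  Hence the
    monoid is conical, its atoms are the generators [v(n)] with [v] a leaf
    ([atom_tgen_leaf], [atomP]), being atomic is (a), and an atom is aperiodic
    exactly when (b) holds at its leaf.  If all elements are sums of atoms and one of
    them is periodic, the shifts of an atom below it all lie among finitely many
    atoms, so that atom is periodic ([atomic_free]).

    From (a) and (b) to semisimplicity.  By (a) the algebra is the sum of the
    left ideals generated by the ghost paths [s_l*] with [src l] a leaf, so it
    is enough that a nonzero [y p_w] with [w] a leaf generates the left ideal
    of [p_w].  For [l] of high degree, [s_l* y p_w] is a combination of ghost
    paths [s_a*] with [rng a = w] and [src a = src l], and by (b) there is only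
    one such [a] ([ghost_absorbs_mul]); some [s_l* y p_w] is not zero, and
    multiplying it by [s_a] gives a nonzero multiple of [p_w].

    From semisimplicity to (a) and (b).  Every left ideal [J] then has, in the
    sense of [socle_split], a complement [C].  If (a) fails, there are paths
    [A_0, A_1, ...], each prolonging the previous one, with a branch [M_i] of
    the same degree as [A_(i+1)] leaving [A_i]; the union of the increasing left
    ideals [{x | x s_(A_i) = 0}] has no complement, since [s_(M_i)*] belongs to
    the one of index [i + 1] and not to the one of index [i].  If (b) fails for
    [a] and [b] at a leaf [w], put [z = p_w - s_a s_b*]; a complement of the
    left ideal of [z] gives [y] with [z = z y z].  To refute this, the algebra
    acts on functions on paths, two functions being identified when they agree
    at all paths of high degree ([interp_equiv]).  The class of functions that
    become constant along the infinite paths out of leaves, even when these are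
    prefixed by a path, is stable under this
    action and [z] kills it ([interp_leaf_constant], [act_cycle]); but [z] maps
    a suitable step function of the degree to the function [-1] on the paths
    from [w], which lies in this class and does not vanish. *)

Set Implicit Arguments.
Unset Strict Implicit.
Unset Printing Implicit Defensive.

Import GRing.Theory.

(** * Paths, leaves and the closure of the set of leaves *)

Section Paths.
Local Open Scope classical_set_scope.
Local Open Scope ring_scope.
Variables (k : nat) (L : kgraph k).
Implicit Types (v w : vertex L) (a b l : mor L) (m n r : 'rV[nat]_k).

Lemma row_nat_addI m : injective (+%R m).
Proof.
move=> x y /matrixP e; apply/matrixP=> i j.
by have := e i j; rewrite !mxE => /addnI.
Qed.

Lemma pcomp_inj a b a' b' : src a = rng b -> src a' = rng b' ->
  deg a = deg a' -> pcomp a b = pcomp a' b' -> a = a' /\ b = b'.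
Proof.
move=> ab ab' da e.
have db : deg b = deg b'.
  by apply: (@row_nat_addI (deg a)); rewrite -deg_comp // e deg_comp // da.
have [p [_ pu]] := unique_factorization (deg_comp ab).
have e1 : p = (a, b) by apply: pu.
have e2 : p = (a', b') by apply: pu.
by move: e2; rewrite e1 => -[-> ->].
Qed.

Lemma path_split l m n : deg l = m + n ->
  exists a b, [/\ src a = rng b, l = pcomp a b, deg a = m & deg b = n].
Proof. by case/unique_factorization=> -[a b] [? _]; exists a, b. Qed.

Lemma deg0_idp l : deg l = 0 -> l = idp (rng l).
Proof.
move=> dl.
have e : pcomp (idp (rng l)) l = pcomp l (idp (src l)).
  by rewrite pcomp_idl pcomp_idr.
by have [] := pcomp_inj _ _ _ e; rewrite ?src_idp ?rng_idp ?deg_idp.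
Qed.

Lemma mem_paths_from v n l : row_finite L ->
  (l \in fset_set (paths_from v n)) = `[< rng l = v /\ deg l = n >].
Proof. by move=> rf; rewrite in_fset_set //; apply/idP/asboolP; rewrite inE. Qed.

Lemma eq_sum_paths_from (V : nmodType) v n (f g : mor L -> V) : row_finite L ->
  (forall l, rng l = v -> deg l = n -> f l = g l) ->
  \sum_(l <- fset_set (paths_from v n)) f l =
  \sum_(l <- fset_set (paths_from v n)) g l.
Proof.
move=> rf fg; rewrite big_seq [RHS]big_seq; apply: eq_bigr => l.
by rewrite mem_paths_from // => /asboolP[]; apply: fg.
Qed.

(** Unique factorization as a reindexing of sums: a path of degree [m + n] is a
    path of degree [m] followed by one of degree [n]. *)
Lemma sum_paths_from (V : nmodType) v m n (g : mor L -> V) : row_finite L ->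
  \sum_(l <- fset_set (paths_from v (m + n))) g l =
  \sum_(a <- fset_set (paths_from v m))
    \sum_(b <- fset_set (paths_from (src a) n)) g (pcomp a b).
Proof.
move=> rf.
have mem u x l := mem_paths_from u x l rf.
rewrite -(big_allpairs_dep (h := fun a b => pcomp a b)) /=; apply: perm_big.
apply: uniq_perm => /=.
- exact: fset_uniq.
- apply: allpairs_uniq_dep => [|a _|].
  + exact: fset_uniq.
  + exact: fset_uniq.
  move=> _ _ /allpairsPdep[a [b [+ + ->]]] /allpairsPdep[a' [b' [+ + ->]]] /=.
  rewrite !mem => /asboolP[_ da] /asboolP[rb _] /asboolP[_ da'] /asboolP[rb' _] e.
  by have [|||<- <-] := pcomp_inj _ _ _ e => //; rewrite da.
move=> l; rewrite mem; apply/asboolP/allpairsPdep.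
  move=> [rl /path_split[a [b [ab el da db]]]]; exists a, b.
  rewrite !mem; split => //; apply/asboolP; split => //.
  by rewrite -rl el rng_comp.
case=> a [b []]; rewrite !mem => /asboolP[ra da] /asboolP[rb db] ->.
by rewrite rng_comp // deg_comp // da db.
Qed.

Lemma row_nat_ind (P : 'rV[nat]_k -> Prop) : P 0 ->
  (forall i m, P m -> P (delta_mx 0 i + m)) -> forall m, P m.
Proof.
move=> P0 PS m; have [s] := ubnP (\sum_i m 0%R i)%N.
elim: s m => // s IH m ms.
have [[i mi]|m0] := pselect (exists i, (0 < m 0%R i)%N); last first.
  suff -> : m = 0 by [].
  apply/matrixP=> i j; rewrite !mxE !ord1; apply/eqP; rewrite -leqn0 leqNgt.
  by apply/negP=> mj; apply: m0; exists j.
pose m' : 'rV[nat]_k := \row_j (m 0%R j - (j == i))%N.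
have em : m = delta_mx 0 i + m'.
  apply/matrixP=> x j; rewrite !mxE !ord1 eqxx /=.
  by have [->|_] := eqVneq j i; rewrite /= ?subn0 ?add0r //; apply/esym/subnKC.
rewrite em; apply/PS/IH; move: ms.
have D (f : 'I_k -> nat) : (\sum_j f j = f i + \sum_(j | j != i) f j)%N.
  exact: bigD1.
rewrite !D (eq_bigr (fun j => m' 0%R j)) => [|j ji]; last first.
  by rewrite [RHS]mxE (negPf ji) subn0.
by rewrite !mxE eqxx subn1; case: (m 0 i) mi.
Qed.

Lemma leaf_uniq v a b : leaf v -> rng a = v -> rng b = v -> deg a = deg b -> a = b.
Proof.
move=> /(_ (deg b))[l e] ra rb d.
have : paths_from v (deg b) a by [].
have : paths_from v (deg b) b by [].
by rewrite e => -> ->.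
Qed.

Hypothesis nosrc : no_sources L.

Lemma leafP v : (forall a b, rng a = v -> rng b = v -> deg a = deg b -> a = b) ->
  leaf v.
Proof.
move=> h n; have [l [rl dl]] := nosrc v n; exists l.
apply/seteqP; split => [x [rx dx]|x ->] //.
by apply: h; rewrite ?dx.
Qed.

Lemma leaf_src l : leaf (rng l) -> leaf (src l).
Proof.
move=> lf; apply: leafP => a b ra rb d.
have e : pcomp l a = pcomp l b.
  by apply: (leaf_uniq lf); rewrite ?rng_comp // !deg_comp // d.
by have [] := pcomp_inj _ _ _ e.
Qed.

(** The vertices from which all paths of some fixed degree end in leaves. *)
Definition leafy v := exists m, forall l, rng l = v -> deg l = m -> leaf (src l).

(** Past the degree that witnesses [leafy], the sources remain leaves. *)
Lemma leafy_witness_add v m r :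
  (forall l, rng l = v -> deg l = m -> leaf (src l)) ->
  forall l, rng l = v -> deg l = m + r -> leaf (src l).
Proof.
move=> h l /[swap] /path_split[a [b [ab -> da db]]].
rewrite rng_comp // src_comp // => ra.
by apply: leaf_src; rewrite -ab; apply: h.
Qed.

Lemma leaf_leafy v : leaf v -> leafy v.
Proof. by exists 0 => l rl _; apply: leaf_src; rewrite rl. Qed.

Lemma leafy_hereditary : hereditary leafy.
Proof.
move=> l [m h]; exists m => b rb db.
have : leaf (src (pcomp l b)).
  apply: (leafy_witness_add h (r := deg l)); first by rewrite rng_comp.
  by rewrite deg_comp // db addrC.
by rewrite src_comp.
Qed.

Lemma leafy_saturated : row_finite L -> saturated leafy.
Proof.
move=> rf v n sub.
have /choice[f hf] : forall a, exists m, paths_from v n a ->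
    forall l, rng l = src a -> deg l = m -> leaf (src l).
  move=> a; have [/(imageP (@src _ L))/sub[m hm]|na] := pselect (paths_from v n a).
    by exists m.
  by exists 0.
pose M := \sum_(a <- fset_set (paths_from v n)) f a.
exists (n + M) => _ /[swap] /path_split[a [b [ab -> da db]]].
rewrite rng_comp // src_comp // => ra.
have pa : paths_from v n a by [].
have ain : a \in fset_set (paths_from v n) by rewrite in_fset_set // inE.
apply: (leafy_witness_add (hf a pa) (m := f a)) => //.
by rewrite db /M (big_fsetD1 a).
Qed.

Lemma hs_closure_leaves : row_finite L -> hs_closure (leaves L) = leafy.
Proof.
move=> rf; apply/seteqP; split=> [v|v [m h]].
  apply; split; first by split; [exact: leafy_hereditary|exact: leafy_saturated].
  by move=> u; apply: leaf_leafy.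
move=> X [[_ sat] sub]; apply: (sat _ m) => _ [l [rl dl] <-].
exact/sub/h.
Qed.

(** No leaf has two paths of different degrees with the same source: the unique
    infinite path out of a leaf visits no vertex twice. *)
Definition leaf_aperiodic := forall a b, leaf (rng a) -> rng a = rng b ->
  src a = src b -> deg a = deg b.

Lemma segment_prefix t a : segment t 0 (deg a) a ->
  exists2 x, src a = rng x & t = pcomp a x.
Proof.
move=> [m1 [m3 [s1 s3 -> d1 _]]]; exists m3 => //.
by rewrite {1}(deg0_idp d1) -[rng m1]src_idp -(deg0_idp d1) s1 pcomp_idl.
Qed.

Lemma MCE_common a b t : MCE a b t -> exists x y,
  [/\ src a = rng x, src b = rng y, t = pcomp a x & t = pcomp b y].
Proof.
by case=> _ /segment_prefix[x sx tx] /segment_prefix[y sy ty]; exists x, y.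
Qed.

Lemma MCE_disjoint a b : a <> b -> deg a = deg b -> MCE a b = set0.
Proof.
move=> ab d; apply/seteqP; split => // t /MCE_common[x [y [sx sy -> e]]].
by have [/ab] := pcomp_inj sx sy d e.
Qed.

Lemma kgraph_aperiodicP : (forall v, leafy v) ->
  kgraph_aperiodic L <-> leaf_aperiodic.
Proof.
move=> all_leafy; split=> [ap a b lf rab sab|ap a b ab sab].
  apply: contrapT => dab.
  have [|t [rt]] := ap a b _ sab; first by move=> e; apply: dab; rewrite e.
  have at_ : src a = rng t by [].
  have bt_ : src b = rng t by rewrite -sab.
  set x := pcomp a t; set y := pcomp b t => /seteqP[+ _].
  have [z [rz dz]] := nosrc (rng a) (deg_join (deg x) (deg y)).
  have seg u : rng u = rng a -> (exists m, deg z = deg u + m) ->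
      segment z 0 (deg u) u.
    move=> ru [m /path_split[u' [z' [uz' ez du' dz']]]].
    have u'E : u' = u.
      by apply: (leaf_uniq lf) => //; rewrite -rz ez rng_comp.
    exists (idp (rng u)), z'; rewrite src_idp deg_idp pcomp_idl add0r -u'E.
    by split=> //; rewrite -u'E.
  have joinD (m n : 'rV[nat]_k) : exists r, deg_join m n = m + r.
    exists (\row_i (maxn (m 0%R i) (n 0%R i) - m 0%R i)%N).
    apply/matrixP=> i j; rewrite !mxE !ord1.
    by apply/esym/subnKC/leq_maxl.
  have joinC (m n : 'rV[nat]_k) : deg_join m n = deg_join n m.
    by apply/matrixP=> i j; rewrite !mxE maxnC.
  move=> /(_ z); apply; split=> //.
    by apply: seg; [rewrite rng_comp | rewrite dz; apply: joinD].
  by apply: seg; [rewrite rng_comp | rewrite dz joinC; apply: joinD].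
have [dab|dab] := pselect (deg a = deg b).
  exists (idp (src a)); rewrite rng_idp; split=> //.
  by rewrite pcomp_idr sab pcomp_idr; apply: MCE_disjoint.
have [m hm] := all_leafy (src a).
have [t [rt dt]] := nosrc (src a) m.
exists t; split=> //; apply/seteqP; split=> // z /MCE_common[x [y []]].
have at_ : src a = rng t by [].
have bt_ : src b = rng t by rewrite -sab.
rewrite !src_comp // => tx ty -> e.
have [] : deg a <> deg b by [].
have dxy : deg x = deg y.
  apply: ap; rewrite -?tx -?ty //; first exact: hm.
  by have := congr1 (@src _ L) e; rewrite !src_comp // src_comp.
have := congr1 (@deg _ L) e; rewrite !deg_comp ?src_comp // dxy -!addrA.
by rewrite [LHS]addrC [RHS]addrC => /row_nat_addI.
Qed.

End Paths.

(** * The talented monoid *)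

Section Talented.
Local Open Scope classical_set_scope.
Local Open Scope ring_scope.
Local Open Scope quotient_scope.
Variables (k : nat) (L : kgraph k).
Hypotheses (rf : row_finite L) (nosrc : no_sources L).
Implicit Types (u v w : vertex L) (l : mor L) (m r : 'rV[nat]_k).
Implicit Types (n N : 'rV[int]_k) (x y z : tterm L) (a b c : talented L).
Implicit Types (P : pred (vertex L)).

Local Notation pi_T x := (\pi_(talented L) x).

(** Degrees as elements of the group that acts on the talented monoid. *)
Definition embZ m : 'rV[int]_k := map_mx Posz m.

Lemma embZ0 : embZ 0 = 0.
Proof. by apply/matrixP=> i j; rewrite !mxE. Qed.

Lemma embZD m r : embZ (m + r) = embZ m + embZ r.
Proof. by apply/matrixP=> i j; rewrite !mxE. Qed.

Lemma embZ_delta i : embZ (delta_mx 0 i) = delta_mx 0 i.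
Proof. by apply/matrixP=> x j; rewrite !mxE; case: (_ && _). Qed.

Lemma embZ_inj : injective embZ.
Proof.
move=> m r /matrixP e; apply/matrixP=> i j.
by have := e i j; rewrite !mxE => -[].
Qed.

(** [evZ Q] says that [Q] holds at all high levels, that is, on a translate of
    the positive cone. *)
Definition evZ (Q : 'rV[int]_k -> Prop) := exists N, forall m, Q (N + embZ m).

Lemma evZ_ge n : evZ (fun N => exists m, N = n + embZ m).
Proof. by exists n => m; exists m. Qed.

Lemma evZ_ex (Q : 'rV[int]_k -> Prop) : evZ Q -> exists N, Q N.
Proof. by case=> N /(_ 0) h; exists (N + embZ 0). Qed.

Lemma evZ_all (Q : 'rV[int]_k -> Prop) : (forall N, Q N) -> evZ Q.
Proof. by move=> h; exists 0. Qed.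

Lemma evZ_imp2 (Q1 Q2 Q : 'rV[int]_k -> Prop) :
  (forall N, Q1 N -> Q2 N -> Q N) -> evZ Q1 -> evZ Q2 -> evZ Q.
Proof.
move=> h [N1 h1] [N2 h2].
have [r1 [r2 e]] : exists r1 r2, N1 + embZ r1 = N2 + embZ r2.
  have /choice[f hf] i : exists p : nat * nat,
      N1 0 i + Posz p.1 = N2 0 i + Posz p.2.
    case E: (N2 0 i - N1 0 i) => [p|q].
      by exists (p, 0%N); rewrite /= -E addr0 addrC subrK.
    exists (0%N, q.+1); rewrite /= (_ : Posz q.+1 = - Negz q) //.
    by rewrite addr0 -E opprB addrC subrK.
  exists (\row_i (f i).1), (\row_i (f i).2).
  by apply/matrixP=> i j; rewrite !mxE !ord1.
exists (N1 + embZ r1) => m.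
by apply: h; [rewrite -addrA -embZD | rewrite e -addrA -embZD].
Qed.

Lemma evZ_imp (Q1 Q : 'rV[int]_k -> Prop) :
  (forall N, Q1 N -> Q N) -> evZ Q1 -> evZ Q.
Proof. by move=> h q; apply: (evZ_imp2 _ q q) => N + _; apply: h. Qed.

Lemma evZ_and (Q1 Q2 : 'rV[int]_k -> Prop) :
  evZ Q1 -> evZ Q2 -> evZ (fun N => Q1 N /\ Q2 N).
Proof. by apply: evZ_imp2. Qed.

Lemma evZ_ex2 (Q1 Q2 : 'rV[int]_k -> Prop) :
  evZ Q1 -> evZ Q2 -> exists N, Q1 N /\ Q2 N.
Proof. by move=> q1 q2; apply: evZ_ex; apply: evZ_and q1 q2. Qed.

(** The paths that lead from the generator [v(n)] to the level [N]. *)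
Definition level v n N : set (mor L) :=
  [set l | rng l = v /\ n + embZ (deg l) = N].

Lemma level_paths_from v n m : level v n (n + embZ m) = paths_from v m.
Proof.
apply/seteqP; split=> l [rl]; last by move=> dl; split=> //; rewrite dl.
by move=> /addrI /embZ_inj.
Qed.

(** The number of paths from the generators of [x] to the level [N] whose
    source satisfies [P].  Defining relations preserve it at high levels, which
    makes it an invariant of the class of [x]. *)
Fixpoint tcount P N x : nat :=
  match x with
  | TZero => 0
  | TAdd y z => (tcount P N y + tcount P N z)%N
  | TGen v n => (\sum_(l <- fset_set (level v n N)) P (src l))%N
  end.

Lemma tcount_gen P v n m :
  tcount P (n + embZ m) (TGen v n) =
  (\sum_(l <- fset_set (paths_from v m)) P (src l))%N.
Proof. by rewrite /= level_paths_from. Qed.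

Lemma tcount_equiv x y : tequiv x y ->
  evZ (fun N => forall P, tcount P N x = tcount P N y).
Proof.
elim=> {x y} [x|x y _ h|x y z _ h1 _ h2|x x' y y' _ h1 _ h2|x|x y|x y z|v n i _].
- exact: evZ_all (fun N P => erefl).
- by apply: evZ_imp h.
- by apply: evZ_imp2 h1 h2 => N e1 e2 P; rewrite e1.
- by apply: evZ_imp2 h1 h2 => N e1 e2 P /=; rewrite e1 e2.
- exact: evZ_all (fun N P => erefl).
- by apply: evZ_all => N P /=; rewrite addnC.
- by apply: evZ_all => N P /=; rewrite addnA.
exists (n + delta_mx 0 i) => m P.
rewrite (big_morph (tcount P _) (id1 := 0%N) (op1 := addn)) //.
rewrite -{1}embZ_delta -addrA -embZD tcount_gen.
rewrite -[LHS]/(\sum_(l <- _) _) sum_paths_from //.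
apply: eq_sum_paths_from => // l rl dl; rewrite tcount_gen.
by apply: eq_sum_paths_from => // b rb db; rewrite src_comp.
Qed.

(** The count of a chosen expression of [a]; at high levels, it is the count of
    any other one. *)
Definition qcount P N a := tcount P N (repr a).

Lemma qcount_pi x : evZ (fun N => forall P, qcount P N (pi_T x) = tcount P N x).
Proof. exact/tcount_equiv/talented_repr. Qed.

Lemma qcount0 : evZ (fun N => forall P, qcount P N 0 = 0%N).
Proof. exact: (qcount_pi (TZero L)). Qed.

Lemma qcountD a b :
  evZ (fun N => forall P, qcount P N (a + b) = (qcount P N a + qcount P N b)%N).
Proof. exact: (qcount_pi (TAdd (repr a) (repr b))). Qed.

Lemma qcount_sum (s : seq (talented L)) :
  evZ (fun N => forall P,
    qcount P N (\sum_(a <- s) a) = (\sum_(a <- s) qcount P N a)%N).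
Proof.
elim: s => [|a s IH].
  by apply: evZ_imp qcount0 => N h P; rewrite !big_nil.
apply: evZ_imp2 IH (qcountD a (\sum_(a <- s) a)) => N h1 h2 P.
by rewrite !big_cons h2 h1.
Qed.

Lemma qcount_gen v n : evZ (fun N => exists2 m, N = n + embZ m &
  forall P, qcount P N (tgen v n) =
    (\sum_(l <- fset_set (paths_from v m)) P (src l))%N).
Proof.
apply: evZ_imp2 (qcount_pi (TGen v n)) (evZ_ge n) => N h [m em]; exists m => // P.
by rewrite h em tcount_gen.
Qed.

(** At a high level, a leaf has a single descendant. *)
Lemma qcount_leaf v n : leaf v -> evZ (fun N => exists l,
  [/\ rng l = v, N = n + embZ (deg l) &
      forall P, qcount P N (tgen v n) = P (src l)]).
Proof.
move=> lf; apply: evZ_imp (qcount_gen v n) => N [m em h].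
have [l [rl dl]] := nosrc v m; exists l; rewrite dl; split=> // P.
rewrite h (_ : paths_from v m = [set l]) ?fset_set1 ?big_seq_fset1 //.
apply/seteqP; split=> [a [ra da]|a ->] //.
by apply: (leaf_uniq lf); rewrite ?dl.
Qed.

Lemma talented_ind (Q : talented L -> Prop) : Q 0 ->
  (forall a b, Q a -> Q b -> Q (a + b)) -> (forall v n, Q (tgen v n)) ->
  forall a, Q a.
Proof.
move=> Q0 QD Qg; elim/quotW; elim=> [|x hx y hy|v n].
- exact: Q0.
- by rewrite talented_piD; apply: QD.
- exact: Qg.
Qed.

(** The defining relations of the talented monoid, from the generators [e_i] to
    all degrees. *)
Lemma tgen_sum v n m :
  tgen v n = \sum_(l <- fset_set (paths_from v m)) tgen (src l) (n + embZ m).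
Proof.
move: v n; elim/row_nat_ind: m => [|i m IH] v n.
  rewrite (_ : paths_from v 0 = [set idp v]).
    by rewrite fset_set1 big_seq_fset1 src_idp embZ0 addr0.
  apply/seteqP; split=> [l [rl /deg0_idp]|_ ->]; first by rewrite rl.
  by rewrite /paths_from /= rng_idp deg_idp.
rewrite sum_paths_from // embZD embZ_delta addrA.
have /talentedP/eqP e := tequiv_gen n (nosrc v (delta_mx 0 i)).
rewrite [LHS]e.
rewrite (big_morph (fun x => pi_T x) (id1 := 0) (op1 := +%R)) //; last first.
  by move=> x y; rewrite talented_piD.
apply: eq_sum_paths_from => // l rl dl.
rewrite [LHS](IH (src l)); apply: eq_sum_paths_from => // b rb db.
by rewrite src_comp.
Qed.

Lemma tgen_leaf l n : leaf (rng l) ->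
  tgen (rng l) n = tgen (src l) (n + embZ (deg l)).
Proof.
move=> lf; rewrite (tgen_sum (rng l) n (deg l)).
rewrite (_ : paths_from _ _ = [set l]) ?fset_set1 ?big_seq_fset1 //.
apply/seteqP; split=> [a [ra da]|a ->] //.
exact: (leaf_uniq lf).
Qed.

Lemma qcount_gt0 a : a <> 0 -> evZ (fun N => (0 < qcount predT N a)%N).
Proof.
elim/talented_ind: a => [|a b ha hb ab|v n _] //.
  have [a0|a0] := pselect (a = 0).
    by rewrite a0 add0r in ab *; apply: hb.
  by apply: evZ_imp2 (ha a0) (qcountD a b) => N h ->; rewrite ltn_addr.
apply: evZ_imp (qcount_gen v n) => N [m _ ->].
have [l [rl dl]] := nosrc v m.
rewrite (big_fsetD1 l) ?mem_paths_from //; exact/asboolP.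
Qed.

Lemma tgen_neq0 v n : tgen v n <> 0.
Proof.
move=> e; have [N [[m _ h] h0]] := evZ_ex2 (qcount_gen v n) qcount0.
have := h0 predT; rewrite -e h.
have [l [rl dl]] := nosrc v m.
rewrite (big_fsetD1 l) ?mem_paths_from //; exact/asboolP.
Qed.

Lemma talented_conical a b : a + b = 0 -> a = 0.
Proof.
move=> ab; apply: contrapT => /qcount_gt0 a0.
have [N [+ [h0 h]]] := evZ_ex2 a0 (evZ_and qcount0 (qcountD a b)).
by have := h predT; rewrite ab h0; case: qcount.
Qed.

Lemma talented_munit a : munit a -> a = 0.
Proof. by case=> b /esym/talented_conical. Qed.

Lemma atom_tgen_leaf v n : leaf v -> atom (tgen v n).
Proof.
move=> lf; split=> [/talented_munit/tgen_neq0 //|b c e].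
have [->|b0] := pselect (b = 0); first by left; exists 0; rewrite addr0.
have [->|c0] := pselect (c = 0); first by right; exists 0; rewrite addr0.
have := evZ_and (qcount_gt0 b0) (qcount_gt0 c0).
have /evZ_ex2/[apply] := evZ_and (qcount_leaf n lf) (qcountD b c).
case=> N [[[l [_ _ hl]] hD] [hb hc]].
have := hD predT; rewrite -e hl /= => h1.
by have := leq_add hb hc; rewrite -h1.
Qed.

Lemma atomP a : atom a -> exists v n, leaf v /\ a = tgen v n.
Proof.
elim/talented_ind: a => [|a b ha hb|v n].
- by case=> + _; case; exists 0; rewrite addr0.
- move=> ab; have [_ /(_ a b erefl)[]/talented_munit e0] := ab.
    by rewrite e0 add0r in ab *; apply: hb.
  by rewrite e0 addr0 in ab *; apply: ha.
move=> [_ at_]; exists v, n; split=> //; apply: (leafP nosrc) => l l' rl rl' d.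
apply: contrapT => ll'; have := tgen_sum v n (deg l).
rewrite (big_fsetD1 l) ?mem_paths_from //=; last exact/asboolP.
rewrite (big_fsetD1 l') /=; last first.
  rewrite !inE mem_paths_from //; apply/andP; split; last exact/asboolP.
  by apply/eqP=> e; apply: ll'.
move=> /at_[] /talented_munit; first exact: tgen_neq0.
by move/talented_conical; apply: tgen_neq0.
Qed.

Lemma atomic_leafy : atomic (talented L) -> forall v, leafy v.
Proof.
move=> at_ v; have [|s [sat e]] := at_ (tgen v 0).
  by move/talented_munit; apply: tgen_neq0.
pose P : pred (vertex L) := fun u => `[< ~ leaf u >].
have : evZ (fun N => \sum_(a <- s) qcount P N a = 0%N)%N.
  elim: s sat {e} => [_|a s IH sat].
    by apply: evZ_all => N; rewrite big_nil.
  have [|w [n [lf ea]]] := @atomP a; first by apply: sat; rewrite mem_head.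
  have h1 := qcount_leaf n lf.
  have h2 : evZ (fun N => \sum_(a <- s) qcount P N a = 0%N)%N.
    by apply: IH => b bs; apply: sat; rewrite inE bs orbT.
  apply: evZ_imp2 h1 h2 => N [l [rl _ h]] h2; rewrite big_cons h2 ea h addn0.
  by rewrite /P asboolF //; apply; apply: (leaf_src nosrc); rewrite rl.
move=> h; have [N [[m _ hv] [hs h0]]] :=
  evZ_ex2 (qcount_gen v 0) (evZ_and (qcount_sum s) h).
exists m => l rl dl; apply: contrapT => nl.
have := hs P; rewrite h0 -e hv (big_fsetD1 l) ?mem_paths_from //=.
  by rewrite /P asboolT.
exact/asboolP.
Qed.

Lemma leafy_atomic : (forall v, leafy v) -> atomic (talented L).
Proof.
move=> lfy a _; elim/talented_ind: a => [|a b [s [sa ->]] [t [ta ->]]|v n].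
- by exists [::]; rewrite big_nil.
- exists (s ++ t); rewrite big_cat; split=> // x.
  by rewrite mem_cat => /orP[/sa|/ta].
have [m hm] := lfy v.
exists [seq tgen (src l) (n + embZ m) | l <- fset_set (paths_from v m)].
split; last by rewrite big_map (tgen_sum v n m).
move=> _ /mapP[l + ->]; rewrite mem_paths_from // => /asboolP[rl dl].
exact/atom_tgen_leaf/hm.
Qed.

(** Distinct shifts of a leaf are equal only if its infinite path returns to a
    vertex. *)
Lemma tgen_leaf_inj v : leaf_aperiodic L -> leaf v -> injective (@tgen k L v).
Proof.
move=> ap lf n n' e.
have [N [[l [rl el hl]] [l' [rl' el' hl']]]] :=
  evZ_ex2 (qcount_leaf n lf) (qcount_leaf n' lf).
have sl : src l = src l'.
  by have := hl (pred1 (src l)); rewrite e hl' /= eqxx; case: eqP.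
have d : deg l = deg l' by apply: ap; rewrite ?rl ?rl'.
by move: el; rewrite el' d => /addIr.
Qed.

(** A generator of a leaf is prime for sums of atoms: at a high level each atom
    involved becomes the generator of a single vertex, and the count of that
    vertex finds the atom of the sum that equals the given one. *)
Lemma tgen_leaf_mem v n b (s : seq (talented L)) : leaf v ->
  {in s, forall a, atom a} -> \sum_(a <- s) a = tgen v n + b -> tgen v n \in s.
Proof.
move=> lf sat e.
pose resolved N a := exists2 u, a = tgen u N & forall P, qcount P N a = P u.
have res w n' : leaf w -> evZ (fun N => resolved N (tgen w n')).
  move=> lfw; apply: evZ_imp (qcount_leaf n' lfw) => N [l [rl -> h]].
  by exists (src l) => //; rewrite -rl tgen_leaf // rl.
have ress : evZ (fun N => {in s, forall a, resolved N a}).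
  elim: s sat {e} => [_|a s IH sat]; first exact: evZ_all.
  have [|w [n' [lfw ea]]] := @atomP a; first by apply: sat; rewrite mem_head.
  have h2 : evZ (fun N => {in s, forall a, resolved N a}).
    by apply: IH => c cs; apply: sat; rewrite inE cs orbT.
  apply: evZ_imp2 (res _ n' lfw) h2 => N; rewrite -ea => ha hs x.
  by rewrite inE => /predU1P[->|/hs].
have [N [[[u eu hu] hs] [hsum hD]]] :=
  evZ_ex2 (evZ_and (res _ n lf) ress)
          (evZ_and (qcount_sum s) (qcountD (tgen v n) b)).
have : (\sum_(a <- s) qcount (pred1 u) N a != 0)%N.
  by rewrite -hsum e hD hu /= eqxx.
rewrite sum_nat_seq_neq0 => /hasP[a as_ /=].
have [u' ea ->] := hs a as_.
by rewrite eqb0 negbK => /eqP eu'; rewrite eu -eu' -ea.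
Qed.

Lemma tshiftDl n n' a : tshift (n + n') a = tshift n (tshift n' a).
Proof.
elim/talented_ind: a => [|a b ha hb|v m]; first by rewrite !tshift0.
  by rewrite !tshiftD ha hb.
by rewrite !tshift_gen addrAC addrA.
Qed.

Lemma atomic_free : atomic (talented L) -> leaf_aperiodic L -> tfree L.
Proof.
move=> at_ ap a [a0 [n [n0 en]]].
have [|s [sat ea]] := at_ a; first by move/talented_munit.
case: s sat ea => [_|x s sat ea]; first by rewrite big_nil.
have [|v [m [lf ex]]] := @atomP x; first by apply: sat; rewrite mem_head.
(* The shifts of the atom [tgen v m] below [a] are pairwise distinct, and all of
   them belong to the finite sum of atoms [a]. *)
have shift_a j : tshift (n *+ j) a = a.
  elim: j => [|j IH]; last by rewrite mulrS tshiftDl IH.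
  by rewrite mulr0n; elim/talented_ind: (a) => [|b c hb hc|w p];
    rewrite ?tshift0 ?tshiftD ?hb ?hc ?tshift_gen ?addr0.
have mem j : tgen v (m + n *+ j) \in x :: s.
  apply: (tgen_leaf_mem (b := tshift (n *+ j) (\sum_(y <- s) y)) _ sat) => //.
  by rewrite -ea -[LHS](shift_a j) ea big_cons tshiftD ex tshift_gen.
have inj : injective (fun j => tgen v (m + n *+ j)).
  move=> i j /(tgen_leaf_inj ap lf)/addrI/matrixP e.
  have [[p np]|np] := pselect (exists p, n 0 p != 0).
    have := e 0 p; rewrite !mulmxnE -mulr_natr -[RHS]mulr_natr => /(mulfI np)/eqP.
    by rewrite !natz => /eqP[].
  case: n0; apply/matrixP=> i' p; rewrite !mxE ord1.
  by apply/eqP/negPn/negP=> h; apply: np; exists p.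
pose t := map (fun j => tgen v (m + n *+ j)) (iota 0 (size s).+2).
have : (size t <= size (x :: s))%N.
  apply: uniq_leq_size; first by rewrite map_inj_uniq // iota_uniq.
  by move=> _ /mapP[j _ ->].
by rewrite size_map size_iota /= ltnn.
Qed.

Lemma atom_aperiodic_leaf : (forall a : talented L, atom a -> taperiodic a) ->
  leaf_aperiodic L.
Proof.
move=> ap a b lf rab sab; apply: contrapT => d.
case: (ap _ (atom_tgen_leaf 0 lf)) => _; apply; split; first exact: tgen_neq0.
exists (embZ (deg a) - embZ (deg b)); split.
  by move/eqP; rewrite subr_eq0 => /eqP/embZ_inj.
rewrite tshift_gen add0r [in LHS]rab tgen_leaf -?rab // subrK -sab.
by rewrite (tgen_leaf 0 lf) add0r.
Qed.

End Talented.

(** * Complements of left ideals in the socle *)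

Section Complements.
Local Open Scope classical_set_scope.
Local Open Scope ring_scope.
Variables (A : zmodType) (mul : A -> A -> A).
Hypothesis mulDr : right_distributive mul +%R.

Lemma left_idealD (I : set A) x y : left_ideal mul I -> I x -> I y -> I (x + y).
Proof.
move=> [I0 Isub _] Ix Iy; rewrite -[y]opprK; apply: (Isub) => //.
by rewrite -sub0r; apply: Isub.
Qed.

(** The set of the sums of an element of [I] and an element of [J]. *)
Definition ideal_sum (I J : set A) : set A :=
  [set x | exists a b, [/\ I a, J b & x = a + b]].

Lemma left_ideal_sum (I J : set A) :
  left_ideal mul I -> left_ideal mul J -> left_ideal mul (ideal_sum I J).
Proof.
move=> [I0 Isub Imul] [J0 Jsub Jmul]; split.
- by exists 0, 0; rewrite addr0.
- move=> _ _ [a [b [Ia Jb ->]]] [c [d [Ic Jd ->]]].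
  by exists (a - c), (b - d); rewrite opprD addrACA; split; auto.
- move=> x _ [a [b [Ia Jb ->]]].
  by exists (mul x a), (mul x b); rewrite mulDr; split; auto.
Qed.

(** An element of the socle splits along any left ideal [J]: a left ideal [C]
    that meets [J] trivially is built greedily, adding one at a time those
    minimal left ideals that are not already contained in [J + C]. *)
Lemma socle_split (J : set A) x : left_ideal mul J -> socle mul x ->
  exists C e, [/\ left_ideal mul C, forall y, J y -> C y -> y = 0, J e & C (x - e)].
Proof.
move=> Jid [s [hs ->]].
have [J0 Jsub _] := Jid.
suff [C [Cid JC hC]] : exists C, [/\ left_ideal mul C,
    forall y, J y -> C y -> y = 0 & {in s, forall y, ideal_sum J C y}].
  have [e [c [Je Cc e_c]]] : ideal_sum J C (\sum_(y <- s) y).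
    rewrite big_seq; elim/big_rec: _ => [|y z ys].
      by have [] := left_ideal_sum Jid Cid.
    exact: left_idealD (left_ideal_sum Jid Cid) (hC y ys).
  by exists C, e; split => //; rewrite e_c addrC addKr.
elim: s hs => [|y s IH] hs.
  exists [set 0]; split=> //.
  split=> // [a b -> ->|a b ->]; first by rewrite subr0.
  by apply: (@addrI _ (mul a 0)); rewrite -mulDr !addr0.
have [|C [Cid JC hC]] := IH; first by move=> z zs; apply: hs; rewrite inE zs orbT.
have [|I [[Iid _ Imin] Iy]] := hs y; first exact: mem_head.
have Kid := left_ideal_sum Jid Cid.
have [IK|nIK] := pselect (I `<=` ideal_sum J C).
  exists C; split=> // z; rewrite inE => /predU1P[->|/hC //]; exact: IK.
(* By minimality, [I] meets [J + C] trivially, and [C + I] replaces [C]. *)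
have I0 : forall z, I z -> ideal_sum J C z -> z = 0.
  have [||e|e] := Imin (I `&` ideal_sum J C).
  - case: Iid Kid => ? Is Im [? Ks Km]; split=> //.
      by move=> a b [] ? ? [] *; split; auto.
    by move=> a b [] *; split; auto.
  - by move=> z [].
  - by move=> z Iz Kz; have : (I `&` ideal_sum J C) z by []; rewrite e.
  - by case: nIK => z; rewrite -e => -[].
have [C0 Csub _] := Cid; have [II0 _ _] := Iid.
exists (ideal_sum C I); split; first exact: left_ideal_sum.
  move=> z Jz [c [u [Cc Iu ez]]].
  have u0 : u = 0.
    apply: I0 => //; exists z, (0 - c); split=> //; first exact: Csub.
    by rewrite ez sub0r addrAC subrr add0r.
  by apply: JC => //; rewrite ez u0 addr0.
move=> z; rewrite inE => /predU1P[->|/hC[a [c [Ja Cc ->]]]].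
  by exists 0, y; rewrite add0r; split=> //; exists 0, y; rewrite add0r.
by exists a, c; split=> //; exists c, 0; rewrite addr0.
Qed.

Lemma socle0 : socle mul 0.
Proof. by exists [::]; rewrite big_nil. Qed.

Lemma socleD x y : socle mul x -> socle mul y -> socle mul (x + y).
Proof.
move=> [s [hs ->]] [t [ht ->]]; exists (s ++ t); rewrite big_cat; split=> // z.
by rewrite mem_cat => /orP[/hs|/ht].
Qed.

Lemma socle_minimal I x : minimal_left_ideal mul I -> I x -> socle mul x.
Proof.
move=> Imin Ix; exists [:: x]; rewrite big_seq1; split=> // y.
by rewrite inE => /eqP ->; exists I.
Qed.

End Complements.

(** * Calculus in the Kumjian-Pask algebra *)

Section KP.
Local Open Scope classical_set_scope.
Local Open Scope ring_scope.
Local Open Scope quotient_scope.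
Variables (F : fieldType) (k : nat) (L : kgraph k).
Implicit Types (u v w : vertex L) (a b l : mor L) (m n r : 'rV[nat]_k).
Implicit Types (x y z : KP F L).

Local Notation "x ** y" := (kp_mul x y) (at level 40, left associativity).
Local Notation pi_KP t := (\pi_(KP F L) t).

(** The generators [p_v], [s_l] and [s_l*]; the last two are [p_v] at the
    identity of [v]. *)
Definition pv v : KP F L := pi_KP (KVertex F v).
Definition sp l : KP F L := pi_KP (kps F l).
Definition st l : KP F L := pi_KP (kpst F l).

Lemma kp_mul0 x : x ** 0 = 0.
Proof. by apply: (@addrI _ (x ** 0)); rewrite -kp_mulDr !addr0. Qed.

Lemma kp_0mul x : 0 ** x = 0.
Proof. by apply: (@addrI _ (0 ** x)); rewrite -kp_mulDl !addr0. Qed.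

Lemma kp_mulN x y : x ** (- y) = - (x ** y).
Proof. by apply: (@addrI _ (x ** y)); rewrite -kp_mulDr !subrr kp_mul0. Qed.

Lemma kp_Nmul x y : (- x) ** y = - (x ** y).
Proof. by apply: (@addrI _ (x ** y)); rewrite -kp_mulDl !subrr kp_0mul. Qed.

Lemma kp_mulBr x y z : x ** (y - z) = x ** y - x ** z.
Proof. by rewrite kp_mulDr kp_mulN. Qed.

Lemma kp_mulBl x y z : (x - y) ** z = x ** z - y ** z.
Proof. by rewrite kp_mulDl kp_Nmul. Qed.

Lemma kp_mul_sumr (I : Type) (s : seq I) x (f : I -> KP F L) :
  x ** \sum_(i <- s) f i = \sum_(i <- s) x ** f i.
Proof. by apply: (big_morph (kp_mul x)) => [y z|]; rewrite ?kp_mulDr ?kp_mul0. Qed.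

Lemma kp_mul_suml (I : Type) (s : seq I) x (f : I -> KP F L) :
  (\sum_(i <- s) f i) ** x = \sum_(i <- s) f i ** x.
Proof.
by apply: (big_morph (fun y => y ** x)) => [y z|]; rewrite ?kp_mulDl ?kp_0mul.
Qed.

Lemma pv_mul u v : pv u ** pv v = if u == v then pv u else 0.
Proof.
rewrite -kp_piM; transitivity (pi_KP (if u == v then KVertex F u else KZero F L)).
  exact/eqP/kpP/kpequiv_vertex.
by case: ifP.
Qed.

Lemma sp_comp l a : src l = rng a -> sp (pcomp l a) = sp l ** sp a.
Proof. by move=> h; rewrite -kp_piM; apply/esym/eqP/kpP/kpequiv_path. Qed.

Lemma st_comp l a : src l = rng a -> st (pcomp l a) = st a ** st l.
Proof. by move=> h; rewrite -kp_piM; apply/esym/eqP/kpP/kpequiv_ghost. Qed.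

Lemma pv_sp l : pv (rng l) ** sp l = sp l.
Proof. by rewrite -kp_piM; apply/eqP/kpP/kpequiv_rng_path. Qed.

Lemma sp_pv l : sp l ** pv (src l) = sp l.
Proof. by rewrite -kp_piM; apply/eqP/kpP/kpequiv_path_src. Qed.

Lemma pv_st l : pv (src l) ** st l = st l.
Proof. by rewrite -kp_piM; apply/eqP/kpP/kpequiv_src_ghost. Qed.

Lemma st_pv l : st l ** pv (rng l) = st l.
Proof. by rewrite -kp_piM; apply/eqP/kpP/kpequiv_ghost_rng. Qed.

Lemma st_sp l a : deg l = deg a -> st l ** sp a = if l == a then pv (src l) else 0.
Proof.
move=> d; rewrite -kp_piM.
transitivity (pi_KP (if l == a then KVertex F (src l) else KZero F L)).
  exact/eqP/kpP/kpequiv_ghost_path.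
by case: ifP.
Qed.

Lemma st_sp_id l : st l ** sp l = pv (src l).
Proof. by rewrite st_sp // eqxx. Qed.

Lemma pv_sum v n : pv v = \sum_(l <- fset_set (paths_from v n)) sp l ** st l.
Proof.
have /kpP/eqP e := kpequiv_path_ghost F v n.
rewrite [LHS]e (big_morph (fun t => pi_KP t) (id1 := 0) (op1 := +%R)) //.
  by apply: eq_bigr => l _; rewrite kp_piM.
by move=> s t; rewrite kp_piD.
Qed.

Lemma kps_idp v : kps F (idp v) = KVertex F v.
Proof. by rewrite /kps insubF ?rng_idp // deg_idp eqxx. Qed.

Lemma sp_idp v : sp (idp v) = pv v.
Proof. by rewrite /sp kps_idp. Qed.

Lemma st_pv_neq l w : rng l <> w -> st l ** pv w = 0.
Proof. by move=> /eqP lw; rewrite -st_pv -kp_mulA pv_mul (negPf lw) kp_mul0. Qed.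

Lemma st_st_neq l a : src a <> rng l -> st l ** st a = 0.
Proof.
by move=> h; rewrite -[st a]pv_st kp_mulA st_pv_neq ?kp_0mul // => e; apply: h.
Qed.

Lemma npath_kps (p : npath L) : KPath F p = kps F (val p).
Proof. by rewrite /kps valK. Qed.

Lemma npath_kpst (p : npath L) : KGhost F p = kpst F (val p).
Proof. by rewrite /kpst valK. Qed.

(** A class of elements that is stable under linear combinations and under left
    multiplication by paths and ghost paths is stable under left
    multiplication. *)
Lemma kp_mul_ind (Q : KP F L -> Prop) :
  (forall x y, Q x -> Q y -> Q (x + y)) -> (forall c x, Q x -> Q (c *: x)) ->
  (forall l x, Q x -> Q (sp l ** x)) -> (forall l x, Q x -> Q (st l ** x)) ->
  forall y x, Q x -> Q (y ** x).
Proof.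
move=> QD QZ Qsp Qst; elim/quotW; elim=> [|t ht|t ht t' ht'|c t ht|t ht t' ht'|v|p|p] x Qx.
- by rewrite (kp_0mul x) -(scale0r x); apply: QZ.
- rewrite kp_piN (kp_Nmul (pi_KP t) x) -scaleN1r; exact/QZ/ht.
- rewrite kp_piD (kp_mulDl (pi_KP t) (pi_KP t') x); apply: QD; [exact: ht|exact: ht'].
- rewrite kp_piZ (kp_scaleAl c (pi_KP t) x); exact/QZ/ht.
- rewrite kp_piM -kp_mulA; exact/ht/ht'.
- rewrite -/(pv v) -sp_idp; exact: Qsp.
- rewrite npath_kps; exact: Qsp.
- rewrite npath_kpst; exact: Qst.
Qed.

(** The sums of sufficiently many vertices are left units for a given element. *)
Lemma kp_local_unit y : exists s : seq (vertex L),
  forall t, uniq t -> {subset s <= t} -> \sum_(u <- t) pv u ** y = y.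
Proof.
have pvU v z : exists s : seq (vertex L),
    forall t, uniq t -> {subset s <= t} -> \sum_(u <- t) pv u ** (pv v ** z) = pv v ** z.
  exists [:: v] => t ut vt; rewrite (bigD1_seq v) ?vt ?mem_head //=.
  rewrite big1 => [|u uv]; first by rewrite addr0 kp_mulA pv_mul eqxx.
  by rewrite kp_mulA pv_mul (negPf uv) kp_0mul.
elim/quotW: y; elim=> [|t ht|t ht t' ht'|c t ht|t ht t' ht'|v|p|p].
- by exists [::] => t _ _; rewrite big1 // => u _; rewrite kp_mul0.
- have [s hs] := ht; exists s => t' ut st'.
  rewrite kp_piN -[RHS]/(- pi_KP t) -[in RHS](hs t') // -sumrN; apply: eq_bigr => u _.
  exact: kp_mulN.
- have [s hs] := ht; have [s' hs'] := ht'; exists (s ++ s') => T uT sT.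
  rewrite kp_piD -[RHS]/(pi_KP t + pi_KP t') -[in RHS](hs T) //; last first.
    by move=> u us; apply: sT; rewrite mem_cat us.
  rewrite -[in RHS](hs' T) //; last by move=> u us; apply: sT; rewrite mem_cat us orbT.
  by rewrite -big_split; apply: eq_bigr => u _; apply: kp_mulDr.
- have [s hs] := ht; exists s => T uT sT.
  rewrite kp_piZ -[RHS]/(c *: pi_KP t) -[in RHS](hs T) // scaler_sumr.
  by apply: eq_bigr => u _; apply: kp_scaleAr.
- have [s hs] := ht; exists s => T uT sT.
  rewrite kp_piM -[in RHS](hs T) // kp_mul_suml.
  by apply: eq_bigr => u _; apply: kp_mulA.
- have := pvU v (pv v); by rewrite pv_mul eqxx.
- have := pvU (rng (val p)) (sp (val p)); by rewrite pv_sp npath_kps.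
- have := pvU (src (val p)) (st (val p)); by rewrite pv_st npath_kpst.
Qed.

Lemma kp_neq0_vertex y : y <> 0 -> exists u, pv u ** y <> 0.
Proof.
move=> y0; apply: contrapT => h; apply: y0.
have [s hs] := kp_local_unit y.
rewrite -(hs (undup s)) ?undup_uniq // => [|u]; last by rewrite mem_undup.
by rewrite big1 // => u _; apply: contrapT => hu; apply: h; exists u.
Qed.

(** The vertices generate the algebra as a left ideal. *)
Lemma kp_vertex_sum x : exists s : seq (KP F L * vertex L),
  x = \sum_(p <- s) p.1 ** pv p.2.
Proof.
have pvU z v : z ** pv v = z -> exists s : seq (KP F L * vertex L),
    z = \sum_(p <- s) p.1 ** pv p.2.
  by move=> e; exists [:: (z, v)]; rewrite big_seq1.
elim/quotW: x; elim=> [|t [s ht]|t [s ht] t' [s' ht']|c t [s ht]|t ht t' [s ht']|v|p|p].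
- by exists [::]; rewrite big_nil.
- exists [seq (- p.1, p.2) | p <- s]; rewrite big_map kp_piN -[LHS]/(- pi_KP t) ht -sumrN.
  by apply: eq_bigr => p _; rewrite kp_Nmul.
- by exists (s ++ s'); rewrite big_cat kp_piD -[LHS]/(pi_KP t + pi_KP t') -ht -ht'.
- exists [seq (c *: p.1, p.2) | p <- s]; rewrite big_map kp_piZ -[LHS]/(c *: pi_KP t) ht.
  by rewrite scaler_sumr; apply: eq_bigr => p _; rewrite kp_scaleAl.
- exists [seq (pi_KP t ** p.1, p.2) | p <- s]; rewrite big_map kp_piM ht' kp_mul_sumr.
  by apply: eq_bigr => p _; rewrite kp_mulA.
- by apply: (pvU _ v); rewrite pv_mul eqxx.
- by apply: (pvU _ (src (val p))); rewrite npath_kps; apply: sp_pv.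
- by apply: (pvU _ (rng (val p))); rewrite npath_kpst; apply: st_pv.
Qed.

End KP.

(** * Leaves generate minimal left ideals *)

Section LeafIdeals.
Local Open Scope classical_set_scope.
Local Open Scope ring_scope.
Variables (F : fieldType) (k : nat) (L : kgraph k).
Hypotheses (rf : row_finite L) (nosrc : no_sources L) (ap : leaf_aperiodic L).
Implicit Types (u v w : vertex L) (a b l : mor L) (m n r : 'rV[nat]_k).
Implicit Types (x y z : KP F L).

Local Notation "x ** y" := (kp_mul x y) (at level 40, left associativity).
Local Notation pv := (pv F).
Local Notation sp := (sp F).
Local Notation st := (st F).

(** For [l] of high degree, [s_l* y] is a multiple of one ghost path [s_a*], with
    [a] a path from [w] to the source of [l].  The path [a] is arbitrary when the
    coefficient is zero, since there may be no path from [w] to that source. *)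
Definition ghost_absorbs w y := exists n, forall l r, deg l = n + r ->
  exists c a, st l ** y = c *: st a /\ (c = 0 \/ rng a = w /\ src a = src l).

(** This is where aperiodicity enters: a leaf has at most one path with a given
    source. *)
Lemma ghost_absorbsD w x y : leaf w ->
  ghost_absorbs w x -> ghost_absorbs w y -> ghost_absorbs w (x + y).
Proof.
move=> lf [n hx] [m hy]; exists (n + m) => l r dl.
have [|c [a [ex ca]]] := hx l (m + r); first by rewrite addrA.
have [|d [b [ey db]]] := hy l (n + r); first by rewrite addrA [m + n]addrC.
rewrite kp_mulDr ex ey.
case: ca => [->|[ra sa]]; first by exists d, b; rewrite scale0r add0r.
case: db => [->|[rb sb]].
  by exists c, a; rewrite scale0r addr0; split=> //; right.
have ab : a = b.
  by apply: (leaf_uniq lf) => //; apply: ap; rewrite ?ra ?rb ?sa ?sb.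
by exists (c + d), a; rewrite scalerDl ab; split=> //; right; rewrite rb sb.
Qed.

Lemma ghost_absorbs_mul w : leaf w -> forall y, ghost_absorbs w (y ** pv w).
Proof.
move=> lf y; have : ghost_absorbs w (pv w).
  exists 0 => l r _; have [rl|rl] := pselect (rng l = w).
    by exists 1, l; rewrite scale1r -{1}rl st_pv; split=> //; right.
  by exists 0, l; rewrite scale0r st_pv_neq //; split=> //; left.
apply: (kp_mul_ind (Q := ghost_absorbs w)) => {y}
  [x y|c x [n hx]|a x [n hx]|a x [n hx]].
- exact: ghost_absorbsD.
- exists n => l r /hx[d [b [e db]]]; exists (c * d), b.
  rewrite kp_scaleAr e scalerA; split=> //.
  by case: db => [->|?]; [left; rewrite mulr0|right].
- exists (deg a + n) => l r; rewrite -addrA => /path_split[l1 [l2 [l12 -> d1 d2]]].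
  rewrite st_comp // src_comp // -kp_mulA [st l1 ** _]kp_mulA st_sp // l12.
  case: eqP => [_|_]; last first.
    by exists 0, a; rewrite kp_0mul kp_mul0 scale0r; split=> //; left.
  by rewrite kp_mulA st_pv; apply: (hx l2 r).
- exists n => l r dl; rewrite kp_mulA.
  have [al|al] := pselect (src a = rng l); last first.
    by exists 0, a; rewrite st_st_neq // kp_0mul scale0r; split=> //; left.
  have [|c [b [e cb]]] := hx (pcomp a l) (deg a + r).
    by rewrite deg_comp // dl addrCA.
  by exists c, b; rewrite -st_comp // e; rewrite src_comp in cb.
Qed.

Lemma sp_st_leaf a : leaf (rng a) -> sp a ** st a = pv (rng a).
Proof.
move=> lf; rewrite (pv_sum F (rng a) (deg a)) (_ : paths_from _ _ = [set a]).
  by rewrite fset_set1 big_seq_fset1.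
apply/seteqP; split=> [b [rb db]|b ->] //.
exact: (leaf_uniq lf).
Qed.

(** A nonzero element of the left ideal of a leaf generates it. *)
Lemma leaf_ideal_generated w y : leaf w -> y ** pv w <> 0 ->
  exists x, x ** (y ** pv w) = pv w.
Proof.
move=> lf /kp_neq0_vertex[u hu].
have [n hn] := ghost_absorbs_mul lf y.
have [l [dl hl]] : exists l, deg l = n /\ st l ** (y ** pv w) <> 0.
  apply: contrapT => h; apply: hu; rewrite (pv_sum F u n) kp_mul_suml.
  rewrite big_seq big1 // => l; rewrite mem_paths_from // => /asboolP[_ dl].
  rewrite -kp_mulA (_ : st l ** _ = 0) ?kp_mul0 //.
  by apply: contrapT => ?; apply: h; exists l.
have [|c [a [e ca]]] := hn l 0; first by rewrite addr0.
have c0 : c != 0 by apply/eqP => c0; apply: hl; rewrite e c0 scale0r.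
case: ca => [/eqP|[ra _]]; first by rewrite (negPf c0).
exists (c^-1 *: (sp a ** st l)).
rewrite kp_scaleAl -kp_mulA e kp_scaleAr scalerA mulVf // scale1r.
by rewrite sp_st_leaf ra.
Qed.

Lemma ghost_ideal_minimal l : leaf (src l) ->
  [set x | exists y, x = y ** st l] <> [set 0] ->
  minimal_left_ideal (@kp_mul F k L) [set x | exists y, x = y ** st l].
Proof.
move=> lf n0; split=> //.
  split; first by exists 0; rewrite kp_0mul.
    by move=> _ _ [y ->] [z ->]; exists (y - z); rewrite kp_mulBl.
  by move=> z _ [y ->]; exists (z ** y); rewrite kp_mulA.
move=> J [J0 _ Jmul] JI.
have [h|h] := pselect (exists2 x, J x & x <> 0); last first.
  left; apply/seteqP; split=> [x Jx|x -> //].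
  by apply: contrapT => x0; apply: h; exists x.
right; apply/seteqP; split=> // _ [z ->].
have [x Jx x0] := h; have [y ex] := JI x Jx.
rewrite -pv_st kp_mulA in ex.
have [|b eb] := @leaf_ideal_generated _ y lf.
  by move=> e; apply: x0; rewrite ex e kp_0mul.
have -> : z ** st l = (z ** b) ** x.
  by rewrite ex -[z ** b ** _]kp_mulA [b ** _]kp_mulA eb pv_st.
exact: Jmul.
Qed.

Lemma leafy_semisimple : (forall v, leafy v) -> semisimple (@kp_mul F k L).
Proof.
move=> lfy; apply/seteqP; split=> // x _.
have [s ->] := kp_vertex_sum x.
elim/big_rec: _ => [|[z v] y _ /= hy]; first exact: socle0.
apply: socleD hy; have [m hm] := lfy v.
rewrite (pv_sum F v m) kp_mul_sumr big_seq.
elim/big_rec: _ => [|l y']; first exact: socle0.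
rewrite mem_paths_from // => /asboolP[rl dl] /(socleD _); apply.
have [e|ne] := pselect ([set x | exists y, x = y ** st l] = [set 0]).
  have : [set x | exists y, x = y ** st l] (z ** (sp l ** st l)).
    by exists (z ** sp l); rewrite kp_mulA.
  by rewrite e => ->; apply: socle0.
apply: (socle_minimal (ghost_ideal_minimal (hm l rl dl) ne)).
by exists (z ** sp l); rewrite kp_mulA.
Qed.

End LeafIdeals.

(** * Representation by germs of functions on paths *)

Section Germs.
Local Open Scope classical_set_scope.
Local Open Scope ring_scope.
Local Open Scope quotient_scope.
Variables (F : fieldType) (k : nat) (L : kgraph k).
Hypotheses (rf : row_finite L) (nosrc : no_sources L).
Implicit Types (u v w : vertex L) (a b l : mor L) (m n r : 'rV[nat]_k).
Implicit Types (x y z : KP F L) (f g h : mor L -> F) (s t : kpterm F L).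

(** Operators on functions on paths.  In terms of indicator functions, a path [a]
    sends [b] to [a b], or to zero if they do not compose, the ghost path of [a]
    sends [a b] to [b] and every other path to zero, and a vertex is a coordinate
    projection. *)
Definition path_op a f : mor L -> F := fun l =>
  if pselect (exists b, src a = rng b /\ l = pcomp a b) is left e
  then f (projT1 (cid e)) else 0.

Definition ghost_op a f : mor L -> F := fun l =>
  if src a == rng l then f (pcomp a l) else 0.

Definition vertex_op v f : mor L -> F := fun l => if rng l == v then f l else 0.

Lemma path_op_comp a b f : src a = rng b -> path_op a f (pcomp a b) = f b.
Proof.
move=> ab; rewrite /path_op; case: pselect => [e|[]]; last by exists b.
case: (cid e) => b' [ab' e'] /=.
by have [_ ->] := pcomp_inj ab ab' erefl e'.
Qed.

Lemma path_op0 a f l :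
  (forall b, src a = rng b -> l = pcomp a b -> False) -> path_op a f l = 0.
Proof. by rewrite /path_op; case: pselect => // -[b [? ?]] /(_ b)[]. Qed.

Lemma ghost_opE a f l : src a = rng l -> ghost_op a f l = f (pcomp a l).
Proof. by rewrite /ghost_op => ->; rewrite eqxx. Qed.

Lemma ghost_op0 a f l : src a <> rng l -> ghost_op a f l = 0.
Proof. by rewrite /ghost_op; case: eqP. Qed.

Lemma vertex_opE f l : vertex_op (rng l) f l = f l.
Proof. by rewrite /vertex_op eqxx. Qed.

Lemma vertex_op0 v f l : rng l <> v -> vertex_op v f l = 0.
Proof. by rewrite /vertex_op; case: eqP. Qed.

Lemma path_opP a f l :
  (exists2 b, src a = rng b & l = pcomp a b) \/ (forall f, path_op a f l = 0).
Proof.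
have [[b [ab e]]|h] := pselect (exists b, src a = rng b /\ l = pcomp a b).
  by left; exists b.
by right=> g; apply: path_op0 => b ab e; apply: h; exists b.
Qed.

(** The action of expressions.  The Kumjian-Pask relations hold at all paths, apart
    from the one that writes [p_v] as a sum over the paths of degree [n], which
    holds at the paths of degree at least [n]. *)
Fixpoint interp t : (mor L -> F) -> mor L -> F :=
  match t with
  | KZero => fun _ _ => 0
  | KOpp s => fun f l => - interp s f l
  | KAdd s s' => fun f l => interp s f l + interp s' f l
  | KScale c s => fun f l => c * interp s f l
  | KMul s s' => fun f => interp s (interp s' f)
  | KVertex v => vertex_op v
  | KPath p => path_op (val p)
  | KGhost p => ghost_op (val p)
  end.

(** Equality at all paths of high degree. *)
Definition germ_eq f g := exists n, forall l r, deg l = n + r -> f l = g l.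

Local Notation "f ~~ g" := (germ_eq f g) (at level 70).

Lemma germ_refl f : f ~~ f. Proof. by exists 0. Qed.

Lemma germ_sym f g : f ~~ g -> g ~~ f.
Proof. by case=> n h; exists n => l r /h. Qed.

Lemma germ_eq2 f g f' g' (op : F -> F -> F) : f ~~ g -> f' ~~ g' ->
  (fun l => op (f l) (f' l)) ~~ (fun l => op (g l) (g' l)).
Proof.
move=> [n h] [n' h']; exists (n + n') => l r dl.
by rewrite (h l (n' + r)) ?(h' l (n + r)) // dl -addrA // addrCA.
Qed.

Lemma germ_eq1 f g (op : F -> F) : f ~~ g -> 
  (fun l => op (f l)) ~~ (fun l => op (g l)).
Proof. by case=> n h; exists n => l r /h ->. Qed.

Lemma germ_trans f g h : f ~~ g -> g ~~ h -> f ~~ h.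
Proof.
move=> [n e] [n' e']; exists (n + n') => l r dl.
by rewrite (e l (n' + r)) ?(e' l (n + r)) // dl -addrA // addrCA.
Qed.

Lemma vertex_op_germ v f g : f ~~ g -> vertex_op v f ~~ vertex_op v g.
Proof. by case=> n h; exists n => l r dl; rewrite /vertex_op (h l r). Qed.

Lemma path_op_germ a f g : f ~~ g -> path_op a f ~~ path_op a g.
Proof.
case=> n h; exists (deg a + n) => l r dl.
have [[b ab el]|e] := path_opP a f l; last by rewrite !e.
rewrite el !path_op_comp // (h b r) //.
apply: (@row_nat_addI _ (deg a)).
by rewrite -deg_comp // -el dl addrA.
Qed.

Lemma ghost_op_germ a f g : f ~~ g -> ghost_op a f ~~ ghost_op a g.
Proof.
case=> n h; exists n => l r dl; rewrite /ghost_op; case: eqP => // al.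
by rewrite (h _ (deg a + r)) // deg_comp // dl addrCA.
Qed.

Lemma interp_germ t f g : f ~~ g -> interp t f ~~ interp t g.
Proof.
elim: t f g => [|t ht|t ht t' ht'|c t ht|t ht t' ht'|v|p|p] f g fg /=.
- exact: germ_refl.
- exact: (germ_eq1 -%R (ht _ _ fg)).
- exact: (germ_eq2 +%R (ht _ _ fg) (ht' _ _ fg)).
- exact: (germ_eq1 ( *%R c) (ht _ _ fg)).
- exact/ht/ht'.
- exact: vertex_op_germ.
- exact: path_op_germ.
- exact: ghost_op_germ.
Qed.

Lemma interp_lin t c f g :
  interp t (fun l => c * f l + g l) = fun l => c * interp t f l + interp t g l.
Proof.
elim: t c f g => [|t ht|t ht t' ht'|d t ht|t ht t' ht'|v|p|p] c f g /=.
- by apply/funext=> l; rewrite mulr0 addr0.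
- by apply/funext=> l; rewrite ht mulrN opprD.
- by apply/funext=> l; rewrite ht ht' mulrDr addrACA.
- by apply/funext=> l; rewrite ht mulrDr mulrCA.
- by rewrite ht' ht.
- by apply/funext=> l; rewrite /vertex_op; case: eqP => //; rewrite mulr0 addr0.
- apply/funext=> l; have [[b ab el]|e] := path_opP (val p) f l.
    by rewrite el !path_op_comp.
  by rewrite !e mulr0 addr0.
- by apply/funext=> l; rewrite /ghost_op; case: eqP => //; rewrite mulr0 addr0.
Qed.

Lemma interp0 t : interp t (fun=> 0) = fun=> 0.
Proof.
have := interp_lin t (-1) (fun=> 0) (fun=> 0).
rewrite (_ : (fun l => _) = fun=> 0); last by apply/funext=> l; rewrite mulr0 addr0.
by move=> ->; apply/funext=> l; rewrite mulN1r addNr.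
Qed.

Lemma interp_kps l : interp (kps F l) = path_op l.
Proof.
rewrite /kps; case: insubP => [p _ <- //|/negPn/eqP/deg0_idp el] /=.
apply/funext=> f; apply/funext=> a; rewrite el rng_idp.
have [ra|ra] := pselect (rng a = rng l).
  rewrite -ra vertex_opE -[X in path_op _ _ X](pcomp_idl a) path_op_comp //.
  by rewrite src_idp.
rewrite vertex_op0 // path_op0 // => b; rewrite src_idp => rb e.
by apply: ra; rewrite e rng_comp ?src_idp ?rng_idp.
Qed.

Lemma interp_kpst l : interp (kpst F l) = ghost_op l.
Proof.
rewrite /kpst; case: insubP => [p _ <- //|/negPn/eqP/deg0_idp el] /=.
apply/funext=> f; apply/funext=> a; rewrite el rng_idp.
have [ra|ra] := pselect (rng a = rng l).
  by rewrite -ra vertex_opE ghost_opE ?src_idp // pcomp_idl.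
by rewrite vertex_op0 // ghost_op0 // src_idp => e; apply: ra.
Qed.

Lemma interp_equiv s t : kpequiv s t -> forall f, interp s f ~~ interp t f.
Proof.
elim=> {s t}; try by move=> *; exact: germ_refl.
- by move=> s t _ h f; apply: germ_sym.
- by move=> s t t' _ h _ h' f; apply: germ_trans (h f) (h' f).
- by move=> s t _ h f; apply: (germ_eq1 -%R (h f)).
- by move=> s s' t t' _ h _ h' f; apply: (germ_eq2 +%R (h f) (h' f)).
- by move=> c s s' _ h f; apply: (germ_eq1 ( *%R c) (h f)).
- move=> s s' t t' _ h _ h' f /=.
  exact: germ_trans (interp_germ s (h' f)) (h _).
- by move=> s t t' f; exists 0 => l r _ /=; rewrite addrA.
- by move=> s t f; exists 0 => l r _ /=; rewrite addrC.
- by move=> s f; exists 0 => l r _ /=; rewrite add0r.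
- by move=> s f; exists 0 => l r _ /=; rewrite addNr.
- by move=> c d s f; exists 0 => l r _ /=; rewrite mulrA.
- by move=> s f; exists 0 => l r _ /=; rewrite mul1r.
- by move=> c s t f; exists 0 => l r _ /=; rewrite mulrDr.
- by move=> c d s f; exists 0 => l r _ /=; rewrite mulrDl.
- move=> s t t' f; exists 0 => l r _ /=.
  have := interp_lin s 1 (interp t f) (interp t' f).
  rewrite (_ : (fun l => _) = fun l => interp t f l + interp t' f l).
    by move=> ->; rewrite mul1r.
  by apply/funext=> a; rewrite mul1r.
- move=> c s t f; exists 0 => l r _ /=.
  have := interp_lin s c (interp t f) (fun=> 0).
  rewrite interp0 (_ : (fun l => _) = fun l => c * interp t f l).
    by move=> ->; rewrite addr0.
  by apply/funext=> a; rewrite addr0.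
- move=> u v f; exists 0 => l r _.
  case: eqP => [<-|uv] /=; rewrite /vertex_op; first by case: eqP.
  by case: eqP => // ->; case: eqP.
- move=> l m lm f; exists 0 => x r _; rewrite /= !interp_kps.
  have [[b ab ->]|e] := path_opP l f x; last first.
    rewrite e path_op0 // => b; rewrite src_comp // => mb ex.
    have := e (path_op m (fun=> 1)); rewrite ex -pcompA // path_op_comp ?rng_comp //.
    by rewrite path_op_comp // => /eqP; rewrite oner_eq0.
  rewrite path_op_comp //; have [[c mc eb]|e] := path_opP m f b.
    rewrite eb path_op_comp // pcompA // path_op_comp // src_comp //.
  rewrite e path_op0 // => c; rewrite src_comp // => mc ex.
  rewrite -pcompA // in ex; have [||_ eb] := pcomp_inj _ _ erefl ex => //.
    by rewrite rng_comp.
  have := e (fun=> 1); rewrite eb path_op_comp // => /eqP.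
  by rewrite oner_eq0.
- move=> l m lm f; exists 0 => x r _; rewrite /= !interp_kpst.
  rewrite /ghost_op src_comp //; case: eqP => // mx.
  by rewrite rng_comp // lm eqxx pcompA.
- move=> l f; exists 0 => x r _; rewrite /= !interp_kps.
  have [[b ab ->]|e] := path_opP l f x; last by rewrite /vertex_op !e if_same.
  by rewrite -[in LHS](rng_comp ab) vertex_opE.
- move=> l f; exists 0 => x r _; rewrite /= !interp_kps.
  have [[b ab ->]|e] := path_opP l f x; last by rewrite !e.
  by rewrite !path_op_comp // ab vertex_opE.
- move=> l f; exists 0 => x r _; rewrite /= !interp_kpst /ghost_op /vertex_op.
  by rewrite eq_sym; case: eqP.
- move=> l f; exists 0 => x r _; rewrite /= !interp_kpst /ghost_op /vertex_op.
  by case: eqP => // lx; rewrite rng_comp // eqxx.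
- move=> l m d f; exists 0 => x r _; rewrite /= interp_kps interp_kpst.
  have [lx|lx] := pselect (src l = rng x); last first.
    by rewrite ghost_op0 //; case: ifP => //= _; rewrite vertex_op0 // => e; apply: lx.
  rewrite ghost_opE //; case: eqP => [<-|lm] /=.
    by rewrite path_op_comp // lx vertex_opE.
  rewrite path_op0 // => b mb e; apply: lm.
  by have [] := pcomp_inj lx mb d e.
move=> v n f; exists n => x r /path_split[a [b [ab ex da db]]] /=.
have sumE (s : seq (mor L)) : interp (\big[@KAdd F k L/KZero F L]_(l <- s)
    KMul (kps F l) (kpst F l)) f x = \sum_(l <- s) path_op l (ghost_op l f) x.
  elim: s => [|l s IH]; first by rewrite !big_nil.
  by rewrite !big_cons /= IH interp_kps interp_kpst.
rewrite sumE {sumE} ex.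
have other l : deg l = n -> l <> a -> path_op l (ghost_op l f) (pcomp a b) = 0.
  move=> dl la; apply: path_op0 => c lc e; apply: la.
  by have [|] := pcomp_inj ab lc _ e; rewrite ?da ?dl.
have [av|av] := pselect (rng a = v); last first.
  rewrite vertex_op0 ?rng_comp // big_seq big1 // => l.
  rewrite mem_paths_from // => /asboolP[rl dl]; apply: other => // e.
  by apply: av; rewrite -e.
rewrite (big_fsetD1 a) /=; last by rewrite mem_paths_from //; apply/asboolP.
rewrite big_seq big1 => [|l].
  by rewrite addr0 path_op_comp // ghost_opE // -av -(rng_comp ab) vertex_opE.
rewrite !inE mem_paths_from // => /andP[/eqP la /asboolP[rl dl]].
exact: other.
Qed.

(** The action of the algebra on functions, well defined up to [germ_eq]. *)
Definition act x f := interp (repr x) f.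

Lemma act_pi t f : act (\pi_(KP F L) t) f ~~ interp t f.
Proof. exact/interp_equiv/kp_repr. Qed.

Lemma act_pv v f : act (pv F v) f ~~ vertex_op v f.
Proof. exact: act_pi. Qed.

Lemma act_mul x y f : act (kp_mul x y) f ~~ act x (act y f).
Proof. exact: act_pi. Qed.

Lemma act_germ x f g : f ~~ g -> act x f ~~ act x g.
Proof. exact: interp_germ. Qed.

Lemma act_subr_mul v a b f :
  act (pv F v - kp_mul (sp F a) (st F b)) f ~~
  (fun l => vertex_op v f l - path_op a (ghost_op b f) l).
Proof.
have := act_pi (KAdd (KVertex F v) (KOpp (KMul (kps F a) (kpst F b)))) f.
rewrite /= interp_kps interp_kpst.
by rewrite kp_piD kp_piN kp_piM.
Qed.

Lemma pv_neq0 v : pv F v <> 0.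
Proof.
move=> e; have h := germ_trans (germ_sym (act_pv v (fun=> 1))) _.
have [n hn] : vertex_op v (fun=> 1) ~~ (fun=> 0).
  by apply: h; rewrite e; apply: (act_pi (KZero F L)).
have [l [rl dl]] := nosrc v n.
have := hn l 0; rewrite addr0 -rl vertex_opE => /(_ dl)/eqP.
by rewrite oner_eq0.
Qed.

End Germs.

(** * Consequences of semisimplicity *)

Section Semisimple.
Local Open Scope classical_set_scope.
Local Open Scope ring_scope.
Variables (F : fieldType) (k : nat) (L : kgraph k).
Hypotheses (rf : row_finite L) (nosrc : no_sources L).
Hypothesis ss : semisimple (@kp_mul F k L).
Implicit Types (u v w : vertex L) (a b l : mor L) (m n r : 'rV[nat]_k).
Implicit Types (x y z : KP F L) (f g h : mor L -> F).

Local Notation "x ** y" := (kp_mul x y) (at level 40, left associativity).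
Local Notation "f ~~ g" := (germ_eq f g) (at level 70).
Local Notation pv := (pv F).
Local Notation sp := (sp F).
Local Notation st := (st F).

Lemma semisimple_split (J : set (KP F L)) x : left_ideal (@kp_mul F k L) J ->
  exists C e, [/\ left_ideal (@kp_mul F k L) C,
    forall y, J y -> C y -> y = 0, J e & C (x - e)].
Proof.
move=> Jid; apply: socle_split Jid _; first exact: kp_mulDr.
by rewrite -/(socle _ x) ss.
Qed.

Lemma not_leafy_branch v : ~ leafy v -> exists p : mor L * mor L,
  [/\ rng p.1 = v, rng p.2 = v, deg p.1 = deg p.2, p.1 <> p.2 & ~ leafy (src p.1)].
Proof.
move=> nl.
have [a [b [ra rb d ab]]] : exists a b, [/\ rng a = v, rng b = v, deg a = deg b & a <> b].
  apply: contrapT => h; apply/nl/(leaf_leafy nosrc)/(leafP nosrc) => a b ra rb d.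
  by apply: contrapT => ab; apply: h; exists a, b.
have [l [rl dl nls]] : exists l, [/\ rng l = v, deg l = deg a & ~ leafy (src l)].
  apply: contrapT => h; apply/nl/(leafy_saturated nosrc rf (n := deg a)).
  by move=> _ [l [rl dl] <-]; apply: contrapT => nls; apply: h; exists l.
have [la|la] := pselect (l = a).
  by exists (l, b); split=> //=; rewrite la.
by exists (l, a).
Qed.

Lemma semisimple_leafy v : leafy v.
Proof.
apply: contrapT => nl.
have /choice[q hq] u : exists p : mor L * mor L, ~ leafy u ->
    [/\ rng p.1 = u, rng p.2 = u, deg p.1 = deg p.2, p.1 <> p.2 & ~ leafy (src p.1)].
  have [lu|/not_leafy_branch[p hp]] := pselect (leafy u); last by exists p.
  by exists (idp u, idp u).
(* The path [A i] leads to a vertex that is not leafy, and [M i] leaves it. *)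
pose A := fix A i := if i is j.+1 then pcomp (A j) (q (src (A j))).1 else idp v.
have hA i : rng (A i) = v /\ ~ leafy (src (A i)).
  elim: i => [|i [rA lA]]; first by rewrite /= rng_idp src_idp.
  by have [r1 _ _ _ l1] := hq _ lA; rewrite /= rng_comp // src_comp.
pose M i := pcomp (A i) (q (src (A i))).2.
pose J := [set x : KP F L | exists i, x ** sp (A i) = 0].
have Jmono x i j : x ** sp (A i) = 0 -> x ** sp (A (i + j)%N) = 0.
  move=> xi; elim: j => [|j IH]; first by rewrite addn0.
  have [r1 _ _ _ _] := hq _ (hA (i + j)%N).2.
  by rewrite addnS /= sp_comp // kp_mulA IH kp_0mul.
have Jid : left_ideal (@kp_mul F k L) J.
  split; first by exists 0%N; rewrite kp_0mul.
    move=> x y [i xi] [j yj]; exists (i + j)%N.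
    by rewrite kp_mulBl (Jmono x) // addnC (Jmono y) // subr0.
  by move=> x y [i yi]; exists i; rewrite -kp_mulA yi kp_mul0.
have [C [e [[_ _ Cmul] JC [i ei] Ce]]] := semisimple_split (pv v) Jid.
have [rA lA] := hA i; have [r1 r2 d12 n12 _] := hq _ lA.
have [J0 Jsub Jmul] := Jid.
have rM : rng (M i) = v by rewrite rng_comp.
have gJ : J (st (M i)).
  exists i.+1; rewrite st_sp; last by rewrite /= !deg_comp // d12.
  case: eqP => // eM; case: n12.
  by have [_ ->] := pcomp_inj (esym r2) (esym r1) erefl eM.
(* Both sides differ by an element of [J] and of [C]. *)
have ge : st (M i) = st (M i) ** e.
  apply/eqP; rewrite -subr_eq0; apply/eqP/JC.
    by apply: Jsub => //; apply: Jmul; exists i.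
  by rewrite -{1}(st_pv F (M i)) rM -kp_mulBr; apply: Cmul.
have : st (M i) ** sp (A i) = 0 by rewrite ge -kp_mulA ei kp_mul0.
rewrite st_comp // -kp_mulA st_sp_id.
have -> : pv (src (A i)) = pv (rng (q (src (A i))).2) by rewrite r2.
rewrite st_pv => st0.
apply: (pv_neq0 rf nosrc (F := F) (v := src (q (src (A i))).2)).
by rewrite -st_sp_id st0 kp_0mul.
Qed.

(** Functions that become constant along the infinite path out of a leaf, also
    after prefixing it with a path. *)
Definition leaf_constant f := forall l, leaf (src l) ->
  exists c n, forall a r, rng a = src l -> deg a = n + r -> f (pcomp l a) = c.

Lemma vertex_op_leaf_constant v f : leaf_constant f -> leaf_constant (vertex_op v f).
Proof.
move=> hf l /hf[c [n hc]]; exists (if rng l == v then c else 0), n => a r ra da.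
by rewrite /vertex_op rng_comp // (hc a r).
Qed.

Lemma path_op_leaf_constant a f : leaf_constant f -> leaf_constant (path_op a f).
Proof.
move=> hf l lf; have [l' [rl' dl']] := nosrc (src l) (deg a).
have [|d [e [de el dd _]]] := @path_split _ _ (pcomp l l') (deg a) (deg l).
  by rewrite deg_comp // dl' addrC.
have le : leaf (src e).
  by rewrite -(src_comp de) -el src_comp //; apply: (leaf_src nosrc); rewrite rl'.
have [c [n hc]] := hf e le.
exists (if d == a then c else 0), (deg a + n) => b r rb.
rewrite -addrA => /path_split[b1 [b2 [b12 eb d1 d2]]].
have b1l : b1 = l'.
  by apply: (leaf_uniq lf); rewrite ?d1 ?dl' // -rb eb rng_comp.
have sl' : src l' = src e by rewrite -(src_comp (esym rl')) el src_comp.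
have lb2 : src l' = rng b2 by rewrite -b1l.
have eb2 : src e = rng b2 by rewrite -sl'.
have -> : pcomp l b = pcomp d (pcomp e b2).
  by rewrite eb b1l (pcompA (esym rl') lb2) el -pcompA.
case: eqP => [<-|da].
  by rewrite path_op_comp ?rng_comp // (hc b2 r).
rewrite path_op0 // => x ax ex; apply: da.
by have [] := pcomp_inj (etrans de (esym (rng_comp eb2))) ax dd ex.
Qed.

Lemma ghost_op_leaf_constant a f : leaf_constant f -> leaf_constant (ghost_op a f).
Proof.
move=> hf l lf; have [al|al] := pselect (src a = rng l); last first.
  by exists 0, 0 => b r rb _; rewrite ghost_op0 // rng_comp.
have [|c [n hc]] := hf (pcomp a l); first by rewrite src_comp.
exists c, n => b r rb db.
by rewrite ghost_opE ?rng_comp // pcompA // (hc b r) // src_comp.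
Qed.

Lemma interp_leaf_constant (t : kpterm F L) f :
  leaf_constant f -> leaf_constant (interp t f).
Proof.
elim: t f => [|t ht|t ht t' ht'|d t ht|t ht t' ht'|v|p|p] f hf /=.
- by move=> l _; exists 0, 0.
- move=> l /(ht f hf)[c [n hc]]; exists (- c), n => a r ra da.
  by rewrite (hc a r).
- move=> l lf; have [c [n hc]] := ht f hf l lf; have [c' [n' hc']] := ht' f hf l lf.
  exists (c + c'), (n + n') => a r ra da.
  by rewrite (hc a (n' + r)) ?(hc' a (n + r)) // da -addrA // addrCA.
- move=> l /(ht f hf)[c [n hc]]; exists (d * c), n => a r ra da.
  by rewrite (hc a r).
- exact/ht/ht'.
- exact: vertex_op_leaf_constant.
- exact: path_op_leaf_constant.
- exact: ghost_op_leaf_constant.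
Qed.

(** For paths [a] and [b] from a leaf [w] to the same vertex, [p_w - s_a s_b*] maps
    [f], on the paths from [w] of high degree, to [f l - f l'], where [l'] is the
    path from [w] with [deg l' - deg l = deg b - deg a]. *)
Lemma act_cycle w a b f : leaf w -> rng a = w -> rng b = w -> src a = src b ->
  forall g, (forall l, rng l <> w -> g l = 0) ->
  (exists n, forall l l' r, rng l = w -> rng l' = w ->
     deg l = deg a + (n + r) -> deg l' = deg b + (n + r) -> g l = f l - f l') ->
  act (pv w - sp a ** st b) f ~~ g.
Proof.
move=> lf ra rb ab g g0 [n gE].
apply: germ_trans (act_subr_mul rf w a b f) _.
exists (deg a + n) => l r dl.
have [rl|rl] := pselect (rng l = w); last first.
  rewrite vertex_op0 // g0 // path_op0 ?subr0 // => c ac e.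
  by apply: rl; rewrite e rng_comp.
have := dl; rewrite -addrA => /path_split[a' [c [ac el da dc]]].
have ea : a' = a by apply: (leaf_uniq lf) => //; rewrite -rl el rng_comp.
rewrite ea in ac el; have bc : src b = rng c by rewrite -ab.
rewrite (gE l (pcomp b c) r) ?rng_comp ?deg_comp ?dc // ?addrA //.
by rewrite -[in vertex_op w]rl vertex_opE {2}el path_op_comp // ghost_opE.
Qed.

Lemma semisimple_no_cycle w a b i : leaf w -> rng a = w -> rng b = w ->
  src a = src b -> (deg a 0%R i < deg b 0%R i)%N -> False.
Proof.
move=> lf ra rb ab dab.
pose z := pv w - sp a ** st b.
have zw : z ** pv w = z.
  by rewrite /z kp_mulBl pv_mul eqxx -kp_mulA -{2}rb st_pv.
have wz : pv w ** z = z.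
  by rewrite /z kp_mulBr pv_mul eqxx kp_mulA -{2}ra pv_sp.
pose J := [set x | exists y, x = y ** z].
have Jid : left_ideal (@kp_mul F k L) J.
  split; first by exists 0; rewrite kp_0mul.
    by move=> _ _ [x ->] [y ->]; exists (x - y); rewrite kp_mulBl.
  by move=> x _ [y ->]; exists (x ** y); rewrite kp_mulA.
have [C [e [[_ _ Cmul] JC [y ey] Ce]]] := semisimple_split (pv w) Jid.
have zyz : z = z ** (y ** z).
  apply/eqP; rewrite -subr_eq0; apply/eqP/JC.
    by exists (pv w - z ** y); rewrite kp_mulBl wz kp_mulA.
  by rewrite -{1}zw -kp_mulBr -ey; apply: Cmul.
pose p := (deg b 0%R i - deg a 0%R i)%N.
have p0 : (0 < p)%N by rewrite subn_gt0.
(* Adding [deg b - deg a] to the degree increases [f] by one, so [z] maps [f] to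
   the constant [-1] on the paths from [w]. *)
pose f : mor L -> F := fun l => (deg l 0%R i %/ p)%:R.
pose g := vertex_op w (fun=> -1 : F).
have zf : act z f ~~ g.
  apply: (act_cycle lf) => // [l rl|]; first exact: vertex_op0.
  exists 0 => l l' r rl rl' dl dl'.
  rewrite /g -rl vertex_opE /f.
  have -> : deg l' 0%R i = (deg l 0%R i + p)%N.
    by rewrite dl dl' !mxE addnAC subnKC // ltnW.
  by rewrite divnDr // divnn p0 addn1 -natr1 opprD addrA subrr sub0r.
have g0 : g ~~ fun=> 0.
  apply: germ_trans (germ_sym zf) _; rewrite zyz.
  apply: germ_trans (act_mul rf _ _ _) _.
  apply: germ_trans (act_germ _ (act_mul rf _ _ _)) _.
  apply: germ_trans (act_germ _ (act_germ _ zf)) _.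
  have : leaf_constant (act y g).
    apply/interp_leaf_constant/vertex_op_leaf_constant => l _.
    by exists (-1), 0.
  move=> /(_ (idp w)); rewrite src_idp => /(_ lf)[c [n hc]].
  have {}hc l r : rng l = w -> deg l = n + r -> act y g l = c.
    by move=> rl dl; rewrite -(pcomp_idl l) rl; apply: hc dl.
  apply: (act_cycle lf) => //; exists n => l l' r rl rl' dl dl'.
  rewrite (hc l (deg a + r)) // ?dl 1?addrCA //.
  by rewrite (hc l' (deg b + r)) ?subrr // dl' addrCA.
have [n hn] := g0; have [l [rl dl]] := nosrc w n.
have := hn l 0; rewrite addr0 /g -rl vertex_opE => /(_ dl)/eqP.
by rewrite oppr_eq0 oner_eq0.
Qed.

Lemma semisimple_leaf_aperiodic : leaf_aperiodic L.
Proof.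
move=> a b lf rab ab; apply/matrixP=> j i; rewrite ord1.
case: (ltngtP (deg a 0%R i) (deg b 0%R i)) => // d.
  by case: (semisimple_no_cycle lf erefl (esym rab) ab d).
rewrite rab in lf.
by case: (semisimple_no_cycle lf erefl rab (esym ab) d).
Qed.

End Semisimple.

Theorem theorem5p13 (k : nat) (k_gt0 : (0 < k)%N) (L : kgraph k)
    (L_row_finite : row_finite L) (L_no_sources : no_sources L)
    (F : fieldType) :
  [<-> semisimple (@kp_mul F k L);
       atomic (talented L) /\ tfree L;
       atomic (talented L) /\
         (forall a : talented L, atom a -> taperiodic a);
       hs_closure (leaves L) = setT /\ kgraph_aperiodic L].
Proof.
have closureP : hs_closure (leaves L) = setT <-> forall v : vertex L, leafy v.
  rewrite hs_closure_leaves //; split=> [e v|h]; first by rewrite e.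
  by apply/seteqP; split=> v // _; apply: h.
tfae.
- move=> ss; have lfy := semisimple_leafy L_row_finite L_no_sources ss.
  have at_ := leafy_atomic L_row_finite L_no_sources lfy; split=> //.
  apply: (atomic_free L_row_finite L_no_sources at_).
  exact: semisimple_leaf_aperiodic ss.
- move=> [at_ fr]; split=> // a [nu _]; split; last exact: fr.
  by move=> a0; apply: nu; exists 0%R; rewrite a0 addr0.
- move=> [at_ ap]; have lfy := atomic_leafy L_row_finite L_no_sources at_.
  split; first exact/closureP.
  apply/(kgraph_aperiodicP L_no_sources lfy).
  exact: atom_aperiodic_leaf ap.
- move=> [/closureP lfy /(kgraph_aperiodicP L_no_sources lfy) ap].
  exact: leafy_semisimple.
Qed.
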